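(* Let $n\geq3$, and for $c\in\mathbb{R}_{>0}$ let $g^c_n$ be the Lorentzian metric on $\mathbb{R}^n$ defined in the context. To every $\Lambda\in\mathbb{R}$ and every nonempty open set $U\subset\mathbb{R}^n$, there exists a number $c_0>0$ such that for all $c\geq c_0$, the metric $g^c_n$ has the following properties: (1) $U$ does not admit a codimension-one foliation none of whose tangent vectors is $g^c_n$-timelike; in particular, $U$ does not admit a $g^c_n$-space foliation. (2) $g^c_n$ satisfies the dominant energy condition with cosmological constant $\Lambda$.
   Context: Definition of $g^c_n$: for $c>0$ consider on $\mathbb{R}^3$ with coordinates $(x_0,x_1,x_2)$ and $\partial_i=\partial/\partial x_i$ the frame $e_0=\frac1c\partial_0$, $e_1=\partial_1-x_2\partial_0$, $e_2=\partial_2$. The Lorentzian metric $g^c_3$ on $\mathbb{R}^3$ is defined by $g^c_3(e_i,e_j)=\varepsilon_i\delta_{ij}$ with $\varepsilon_0=-1$, $\varepsilon_1=\varepsilon_2=1$. For $n\geq3$, $g^c_n$ on $\mathbb{R}^n=\mathbb{R}^3\times\mathbb{R}^{n-3}$ is the product of $g^c_3$ with the euclidean Riemannian metric on $\mathbb{R}^{n-3}$. A vector $v$ is timelike if $g(v,v)<0$, spacelike if $g(v,v)>0$. Foliations are smooth. A space foliation (for a Lorentzian metric) is a codimension-one foliation all of whose nonzero tangent vectors (vectors tangent to the leaves) are spacelike. For $\Lambda\in\mathbb{R}$, the energy-momentum tensor of a Lorentzian metric $g$ with respect to $\Lambda$ is $T=\mathrm{Ric}_g-\frac12\mathrm{scal}_g\,g+\Lambda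 g$. The dominant energy condition with (cosmological constant) $\Lambda$ holds iff for every timelike $v$ one has $T(v,v)\geq0$ and the vector $-\sharp(T(v,\cdot))$ is not spacelike, where $\sharp\colon T^\ast M\to TM$ is the isomorphism induced by $g$. *)

(* Defs.v *)
From HB Require Import structures.
From mathcomp Require Import all_boot all_order all_algebra.
From mathcomp Require Import all_classical all_reals all_analysis.
Set Implicit Arguments.
Unset Strict Implicit.
Unset Printing Implicit Defensive.
Import Order.TTheory GRing.Theory Num.Theory.
Import numFieldNormedType.Exports.
Local Open Scope classical_set_scope.
Local Open Scope ring_scope.

Section Smooth.
Context {R : realType} {n : nat}.

Definition partial (i : 'I_n) (f : 'rV[R]_n -> R) : 'rV[R]_n -> R :=
  fun x => 'D_(delta_mx 0 i) f x.

(* Intended for open V: the derivatives at points of V then depend only on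
   the restriction of f to V. *)
Fixpoint Ck_on (k : nat) (V : set 'rV[R]_n) (f : 'rV[R]_n -> R) : Prop :=
  (forall x, V x -> {for x, continuous f}) /\
  match k with
  | 0 => True
  | k'.+1 => forall i : 'I_n,
      (forall x, V x -> derivable f x (delta_mx 0 i)) /\
      Ck_on k' V (partial i f)
  end.

Definition smooth_on (V : set 'rV[R]_n) (f : 'rV[R]_n -> R) : Prop :=
  forall k, Ck_on k V f.

Definition smooth_map_on (m : nat) (V : set 'rV[R]_n)
    (f : 'rV[R]_n -> 'rV[R]_m) : Prop :=
  forall j : 'I_m, smooth_on V (fun x => f x 0 j).

End Smooth.

Section Foliation.
Context {R : realType} {n : nat}.

Definition is_chart (V : set 'rV[R]_n) (phi : 'rV[R]_n -> 'rV[R]_n) : Prop :=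
  [/\ open V, open (phi @` V), smooth_map_on V phi &
      exists2 psi : 'rV[R]_n -> 'rV[R]_n,
        smooth_map_on (phi @` V) psi & forall x, V x -> psi (phi x) = x].

End Foliation.

Section Codim1Foliation.
Context {R : realType} {n : nat}.
Notation E := 'rV[R]_n.+1.

(* The coordinate of a foliated chart transverse to the leaves: the plaques of
   the chart (V, phi) are the sets {x in V | transverse phi x = t}. *)
Definition transverse (phi : E -> E) : E -> R := fun x => phi x 0 ord_max.

(* A smooth codimension-one foliation of U, given by a foliated atlas: the
   charts cover U, and each transition map has locally the form
   (a, t) |-> (b (a, t), h t) with a in R^n and t in R, so that plaques match
   up to leaves. *)
Definition codim1_foliation (U : set E) (A : set (set E * (E -> E))) : Prop :=
  [/\ forall C, A C -> C.1 `<=` U /\ is_chart C.1 C.2,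
      forall p, U p -> exists2 C, A C & C.1 p &
      forall C C', A C -> A C' -> forall p, C.1 p -> C'.1 p ->
        exists h : R -> R,
          \forall x \near p, transverse C'.2 x = h (transverse C.2 x)].

(* v is tangent at p to the leaf through p, i.e. to the plaque through p of a
   chart of the atlas. *)
Definition tangent_to_leaf (A : set (set E * (E -> E))) (p v : E) : Prop :=
  exists C, [/\ A C, C.1 p & 'D_v (transverse C.2) p = 0].

End Codim1Foliation.

Section LorentzGeometry.
Context {R : realType} {n : nat}.

(* A (0,2)-tensor field on R^n: the matrix of its components in the standard
   coordinates. *)
Definition tensor2 := 'rV[R]_n -> 'M[R]_n.

Definition tensor_eval (S : tensor2) (p v w : 'rV[R]_n) : R :=
  (v *m S p *m w^T) 0 0.

Definition timelike (g : tensor2) (p v : 'rV[R]_n) : Prop :=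
  tensor_eval g p v v < 0.

Definition spacelike (g : tensor2) (p v : 'rV[R]_n) : Prop :=
  tensor_eval g p v v > 0.

(* Gamma^k_(ij) of the Levi-Civita connection *)
Definition christoffel (g : tensor2) (k i j : 'I_n) (p : 'rV[R]_n) : R :=
  2^-1 * \sum_l invmx (g p) k l *
    (partial i (fun x => g x j l) p + partial j (fun x => g x i l) p
     - partial l (fun x => g x i j) p).

(* Sign convention: Ric is positive on round spheres. *)
Definition ricci (g : tensor2) : tensor2 := fun p =>
  \matrix_(i, j)
    (\sum_k (partial k (christoffel g k i j) p
             - partial j (christoffel g k i k) p)
     + \sum_k \sum_l (christoffel g k k l p * christoffel g l i j p
                      - christoffel g k j l p * christoffel g l i k p)).

Definition scal (g : tensor2) (p : 'rV[R]_n) : R :=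
  \tr (invmx (g p) *m ricci g p).

Definition energy_momentum (g : tensor2) (Lambda : R) : tensor2 := fun p =>
  ricci g p - (2^-1 * scal g p) *: g p + Lambda *: g p.

(* The argument is the row of components of a covector. *)
Definition sharp (g : tensor2) (p alpha : 'rV[R]_n) : 'rV[R]_n :=
  alpha *m invmx (g p).

Definition dominant_energy_condition (g : tensor2) (Lambda : R) : Prop :=
  let T := energy_momentum g Lambda in
  forall p v, timelike g p v ->
    0 <= tensor_eval T p v v /\ ~ spacelike g p (- sharp g p (v *m T p)).

End LorentzGeometry.

Arguments tensor2 : clear implicits.

Definition space_foliation {R : realType} {n : nat} (g : tensor2 R n.+1)
    (U : set 'rV[R]_n.+1)
    (A : set (set 'rV[R]_n.+1 * ('rV[R]_n.+1 -> 'rV[R]_n.+1))) : Prop :=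
  codim1_foliation U A /\
  forall p v, tangent_to_leaf A p v -> v != 0 -> spacelike g p v.

Section Metric.
Context {R : realType}.

(* Row i holds the components of e_i in the coordinate basis. *)
Definition frame3 (c : R) (x : 'rV[R]_3) : 'M[R]_3 :=
  \matrix_(i < 3) match val i with
    | 0 => c^-1 *: delta_mx 0 0
    | 1 => delta_mx 0 1 - x 0 2%:R *: delta_mx 0 0
    | _ => delta_mx 0 2%:R
    end.

Definition signature3 : 'M[R]_3 :=
  diag_mx (\row_(i < 3) if i == 0 then -1 else 1).

(* The only G with frame3 c x *m G *m (frame3 c x)^T = signature3; see
   g3_frame. *)
Definition g3 (c : R) : tensor2 R 3 := fun x =>
  invmx (frame3 c x) *m signature3 *m (invmx (frame3 c x))^T.

(* The metric g^c_n on R^n = R^3 x R^(n-3), with n = 3 + m. *)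
Definition gc (c : R) (m : nat) : tensor2 R (3 + m) := fun x =>
  block_mx (g3 c (lsubmx x)) 0 0 1%:M.

Lemma frame3_unit (c : R) (x : 'rV[R]_3) : c != 0 -> frame3 c x \in unitmx.
Proof.
move=> c0; rewrite unitmxE det_trig; last first.
  apply/is_trig_mxP => i j; rewrite !mxE.
  by case: i => [[|[|[|//]]] ?]; case: j => [[|[|[|//]]] ?] //= _;
     rewrite !mxE /= ?mulr0 ?subr0.
have d0 : frame3 c x 0 0 = c^-1 by rewrite !mxE /= mulr1.
have d1 : frame3 c x 1 1 = 1 by rewrite !mxE /= mulr0 subr0.
have d2 : frame3 c x 2%:R 2%:R = 1 by rewrite !mxE.
have -> : \prod_i frame3 c x i i
    = frame3 c x 0 0 * (frame3 c x 1 1 * frame3 c x 2%:R 2%:R).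
  rewrite !big_ord_recl big_ord0 mulr1.
  by congr (_ * (_ * _)); congr (frame3 _ _ _ _); apply: val_inj.
by rewrite d0 d1 d2 !mulr1 unitfE invr_eq0.
Qed.

Lemma g3_frame (c : R) (x : 'rV[R]_3) : c != 0 ->
  frame3 c x *m g3 c x *m (frame3 c x)^T = signature3.
Proof.
move=> c0; have u := frame3_unit x c0.
by rewrite /g3 !mulmxA mulmxV // mul1mx -mulmxA -trmx_mul mulmxV // trmx1 mulmx1.
Qed.

End Metric.

Arguments gc {R} c m x.

(* Main.v *)
Require Import Defs.
From mathcomp Require Import all_boot all_order all_algebra.
From mathcomp Require Import all_classical all_reals all_analysis.
From mathcomp Require Import ring lra.
Set Implicit Arguments.
Unset Strict Implicit.
Unset Printing Implicit Defensive.
Import Order.TTheory GRing.Theory Num.Theory.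
Import numFieldNormedType.Exports.
Local Open Scope classical_set_scope.
Local Open Scope ring_scope.

(* The metric is -c^2 (dx_0 + x_2 dx_1)^2 + dx_1^2 + dx_2^2 + ... .  If no vector
   tangent to a foliation is timelike, then x_0 is transverse to the leaves and,
   in the three-dimensional slices, the leaves are integral surfaces of
   dx_0 + (x_2 + O(1/c)) dx_1 + O(1/c) dx_2.  Over a square of side delta in the
   (x_1, x_2)-plane a leaf is the graph of a function: local graphs exist by the
   intermediate value theorem, have a uniform size by compactness, and glue along
   edges by uniqueness.  Around the boundary of the square dx_0 integrates to 0
   and x_2 dx_1 to the area delta^2 up to sign, so delta^2 <= 4 delta / c, which
   is false for large c.

   In the frame e_0, e_1, e_2, ... the Ricci tensor is
   diag(c^2/2, c^2/2, c^2/2, 0, ..., 0), hence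
   T = diag(3c^2/4 - Lambda, c^2/4 + Lambda, c^2/4 + Lambda,
            Lambda - c^2/4, ...), and the dominant energy condition says that the
   first entry bounds the absolute values of the others. *)

(** * Graphs lying in leaves *)

(** Real induction, by the supremum of the points [x] with [P a x]. The local hypothesis asks only
    for intervals that contain [x], which is what an estimate based at [x] yields: both ends are
    compared with [x]. *)
Lemma interval_induction {R : realType} (P : R -> R -> Prop) (a b : R) :
  a <= b ->
  (forall u v w, u <= v -> v <= w -> P u v -> P v w -> P u w) ->
  (forall x, a <= x <= b -> exists2 d, 0 < d &
     forall u v, a <= u -> v <= b -> x - d < u -> u <= x -> x <= v ->
       v < x + d -> P u v) ->
  P a b.
Proof.
move=> ab trP locP.
pose S := [set x | a <= x <= b /\ P a x].
have Sa : S a.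
  split; first by rewrite lexx.
  have [d d0 Pd] := locP a ltac:(by rewrite lexx).
  by apply: Pd => //; lra.
have bS : ubound S b by move=> x [/andP[]].
have hS : has_sup S by split; [exists a | exists b].
have supa : a <= sup S by apply: ub_le_sup => //; exists b.
have supb : sup S <= b by apply: ge_sup => //; exists a.
have [d d0 Pd] := locP (sup S) ltac:(by rewrite supa).
have [x [/andP[ax xb] Pax] xd] := sup_adherent d0 hS.
have xs : x <= sup S.
  by apply: ub_le_sup; [exists b | split => //; rewrite ax].
have ext v : sup S <= v -> v <= b -> v < sup S + d -> P a v.
  by move=> sv vb vd; apply: (trP a x v) => //; [lra | exact: Pd].
have [bs|bs] := ltP b (sup S + d / 2); first by apply: ext => //; lra.
have : S (sup S + d / 2).
  by split; [apply/andP; split; lra | apply: ext; lra].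
by move=> /(ub_le_sup (ex_intro _ b bS)); lra.
Qed.

Section LeafGraphs.
Context {R : realType} {I : Type}.
Context (dom : I -> R -> R -> R -> Prop) (f : I -> R -> R -> R -> R).
Context (b eps rho delta r M : R).
Implicit Types (Q : R -> R -> Prop) (u : R -> R -> R).

Definition close (d s y s' y' : R) := `|s' - s| < d /\ `|y' - y| < d.

Definition near_on Q (s y : R) (A : R -> R -> Prop) :=
  exists2 d, 0 < d & forall s' y', Q s' y' -> close d s y s' y' -> A s' y'.

(* The integral of the contact form dt + (b + y) ds along the segment from
   (t, s, y) to (t', s', y'). *)
Definition lean (t s y t' s' y' : R) : R :=
  t' - t + (b + (y + y') / 2) * (s' - s).

(** [eps] bounds the deviation of the leaf slopes from those of the contact form. The product term
    absorbs the difference between [y] at an intermediate point and at the midpoint of the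
    segment. *)
Definition slack (s y s' y' : R) : R :=
  (eps + `|y' - y|) * `|s' - s| + eps * `|y' - y|.

Definition compatible := forall i j t s y, dom i t s y -> dom j t s y ->
  exists h : R -> R, exists2 d, 0 < d &
    forall t' s' y', `|t' - t| < d -> close d s y s' y' ->
      f j t' s' y' = h (f i t' s' y').

(* The coordinate [f i] is a local first integral of the foliation; by the slope
   bounds it increases along every segment on which the contact form dominates
   [slack]. *)
Definition adapted i (t0 s0 y0 : R) :=
  [/\ forall t s y, `|t - t0| < r -> close r s0 y0 s y -> dom i t s y,
      forall t s y t' s' y', `|t - t0| < r -> close r s0 y0 s y ->
        `|t' - t0| < r -> close r s0 y0 s' y' ->
        slack s y s' y' < lean t s y t' s' y' -> f i t s y < f i t' s' y' &
      forall t s y, `|t - t0| < r -> close r s0 y0 s y ->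
        {for t, continuous (fun t => f i t s y)}].

Definition in_square (s y : R) := 0 <= s <= delta /\ 0 <= y <= delta.

(** The radius [r] is the same at all points, so that a finite subdivision of the square
    suffices. *)
Definition covered := forall t s y, `|t| <= rho -> in_square s y ->
  exists i, adapted i t s y.

(* The graph of [u] over [Q] lies in one leaf. *)
Definition leafy Q u := forall s y, Q s y ->
  [/\ `|u s y| <= rho,
      near_on Q s y (fun s' y' =>
        `|lean (u s y) s y (u s' y') s' y'| <= slack s y s' y') &
      forall i, dom i (u s y) s y ->
        near_on Q s y (fun s' y' => f i (u s' y') s' y' = f i (u s y) s y)].

Hypothesis fcompat : compatible.
Hypothesis fcov : covered.
Hypothesis bounds : [/\ 0 < eps, 0 < delta, 0 < r, 1 <= M &
                        `|b| + 2 * delta + eps < M].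

(** * Steep segments and local lifts *)

Lemma leanC t s y t' s' y' : lean t' s' y' t s y = - lean t s y t' s' y'.
Proof. by rewrite /lean; field. Qed.

Lemma slackC s y s' y' : slack s' y' s y = slack s y s' y'.
Proof. by rewrite /slack (distrC s) (distrC y). Qed.

(** [M] exceeds [|b| + delta], a bound for the slope of the contact form over the square, plus the
    [eps + delta] coming from [slack]. Hence a climb of [M] times the horizontal displacement
    outweighs both. *)
Lemma steep (t s y t' s' y' : R) : in_square s y -> in_square s' y' ->
  M * (`|s' - s| + `|y' - y|) <= t' - t -> t < t' ->
  slack s y s' y' < lean t s y t' s' y'.
Proof.
case: bounds => eps0 delta0 r0 M1 Mb.
move=> [/andP[s0 sd] /andP[y0 yd]] [/andP[s'0 s'd] /andP[y'0 y'd]] Mt tt'.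
rewrite /slack /lean.
have yy : `|y' - y| <= delta by rewrite ler_norml; apply/andP; split; lra.
have lb : - ((`|b| + delta) * `|s' - s|) <= (b + (y + y') / 2) * (s' - s).
  rewrite lerNl (le_trans (ler_norm _)) // normrN normrM ler_wpM2r //.
  rewrite (le_trans (ler_normD _ _)) // lerD2l ger0_norm; lra.
have := normr_ge0 (s' - s); have := normr_ge0 (y' - y).
have := normr_ge0 b.
move: Mt lb yy Mb; set X := `|s' - s|; set Y := `|y' - y|; set B := `|b|.
move=> Mt lb yy MB B0 Y0 X0.
have h1 : (eps + Y) * X <= (eps + delta) * X by rewrite ler_wpM2r //; lra.
(* The bound on [M] is strict only after multiplication by a nonzero displacement; for a vertical
   segment strictness comes from [t < t']. *)
have [X00|X00] := eqVneq X 0.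
  have [Y00|Y00] := eqVneq Y 0; first by rewrite X00 Y00 in Mt lb h1 *; lra.
  have : eps * Y < M * Y by rewrite ltr_pM2r; lra.
  by rewrite X00 in Mt lb h1 *; nra.
have : (B + 2 * delta + eps) * X < M * X by rewrite ltr_pM2r // lt_def X00.
have : eps * Y <= M * Y by rewrite ler_wpM2r //; lra.
nra.
Qed.

Lemma near_onI Q s y (A B : R -> R -> Prop) :
  near_on Q s y A -> near_on Q s y B ->
  near_on Q s y (fun s' y' => A s' y' /\ B s' y').
Proof.
move=> [d d0 dA] [e e0 eB]; exists (Num.min d e); first by rewrite lt_min d0.
by move=> s' y' Q' []; rewrite !lt_min => /andP[? ?] /andP[? ?]; split;
  [exact: dA|exact: eB].
Qed.

Lemma near_onU Q Q' s y (A : R -> R -> Prop) :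
  near_on Q s y A -> near_on Q' s y A ->
  near_on (fun s y => Q s y \/ Q' s y) s y A.
Proof.
move=> [d d0 dA] [e e0 eA]; exists (Num.min d e); first by rewrite lt_min d0.
by move=> s' y' + []; rewrite !lt_min => + /andP[? ?] /andP[? ?] => -[?|?];
  [exact: dA|exact: eA].
Qed.

Lemma near_on_sub Q Q' s y (A B : R -> R -> Prop) :
  (forall s y, Q' s y -> Q s y) ->
  (forall s y, Q' s y -> A s y -> B s y) ->
  near_on Q s y A -> near_on Q' s y B.
Proof.
move=> Q'Q AB [d d0 dA]; exists d => // s' y' Q'z' zz'.
by apply: AB => //; apply: dA => //; exact: Q'Q.
Qed.

Lemma leafy_sub Q Q' u : (forall s y, Q' s y -> Q s y) ->
  leafy Q u -> leafy Q' u.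
Proof.
move=> Q'Q uQ s y /Q'Q Qsy; have [ur ul uf] := uQ _ _ Qsy; split => //.
  exact: near_on_sub ul.
by move=> i /uf; exact: near_on_sub.
Qed.

(** Contrapositive of [steep], used in both directions of the segment: a jump of [e] over a
    displacement this small would be too steep. *)
Lemma lean_small (s y e : R) : in_square s y -> 0 < e ->
  exists2 d, 0 < d & forall t s' y' t', in_square s' y' -> close d s y s' y' ->
    `|lean t s y t' s' y'| <= slack s y s' y' -> `|t' - t| < e.
Proof.
case: bounds => eps0 delta0 r0 M1 Mb; have M0 : 0 < M by lra.
move=> sy e0; exists (e / (4 * M)); first by rewrite divr_gt0 // mulr_gt0.
move=> t s' y' t' sy' [ds dy] ll.
have h : M * (`|s' - s| + `|y' - y|) < e.
  have : M * `|s' - s| < M * (e / (4 * M)) by rewrite ltr_pM2l //; lra.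
  have : M * `|y' - y| < M * (e / (4 * M)) by rewrite ltr_pM2l //; lra.
  rewrite (_ : M * (e / (4 * M)) = e / 4); last by field; lra.
  by lra.
have N0 : 0 <= M * (`|s' - s| + `|y' - y|) by rewrite mulr_ge0 ?addr_ge0 //; lra.
rewrite ltNge; apply/negP; rewrite ler_normr => /orP[] et.
  have := @steep t s y t' s' y' sy sy' ltac:(lra) ltac:(lra).
  by move: (le_trans (ler_norm _) ll); lra.
have hM : M * (`|s - s'| + `|y - y'|) <= t - t' by rewrite distrC (distrC y); lra.
have := steep sy' sy hM ltac:(lra).
rewrite leanC slackC.
by move: ll; rewrite ler_norml => /andP[]; lra.
Qed.

Lemma closexx (d s y : R) : 0 < d -> close d s y s y.
Proof. by move=> d0; rewrite /close !subrr normr0. Qed.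

(** Above each point of [Q], [steep] puts the first integral at height [t0 - D] below, and at
    [t0 + D] above, its value at the base point; the intermediate value theorem gives a height where
    the values agree. Since [M * (w + v) < r], a single chart suffices. *)
Lemma leafy_lift Q (t0 s0 y0 w v : R) : 0 <= w -> 0 <= v ->
  in_square s0 y0 -> Q s0 y0 ->
  (forall s y, Q s y -> [/\ in_square s y, `|s - s0| <= w & `|y - y0| <= v]) ->
  `|t0| + M * (w + v) <= rho -> M * (w + v) < r ->
  exists2 u, leafy Q u & u s0 y0 = t0.
Proof.
case: bounds => eps0 delta0 r0 M1 Mb w0 v0 sq0 Q0 Qb trho Mr.
have Mw : 0 <= M * w by rewrite mulr_ge0 //; lra.
have Mv : 0 <= M * v by rewrite mulr_ge0 //; lra.
have wr : w < r by nra.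
have vr : v < r by nra.
have [i [idom imono icont]] := fcov (t := t0) ltac:(lra) sq0.
have Qcl s y : Q s y -> close r s0 y0 s y.
  by move=> /Qb[_ sw yv]; split; lra.
have QM s y : Q s y -> 0 <= M * (`|s - s0| + `|y - y0|) <= M * (w + v).
  move=> /Qb[_ sw yv]; rewrite mulr_ge0 /= ?addr_ge0 //; last by lra.
  by rewrite ler_wpM2l //; lra.
have ex s y : exists t, Q s y ->
    `|t - t0| <= M * (`|s - s0| + `|y - y0|) /\ f i t s y = f i t0 s0 y0.
  have [Qsy|nQ] := pselect (Q s y); last by exists 0.
  have [sqsy _ _] := Qb _ _ Qsy; have /andP[D0 DM] := QM _ _ Qsy.
  set D := M * _ in D0 DM *.
  have inr t : t0 - D <= t <= t0 + D -> `|t - t0| < r.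
    move=> /andP[? ?]; have : `|t - t0| <= D by rewrite ler_norml; apply/andP; split; lra.
    by lra.
  have [|||t] := @IVT R (fun t => f i t s y) (t0 - D) (t0 + D) (f i t0 s0 y0).
  - by lra.
  - apply: continuous_in_subspaceT => t; rewrite inE/= in_itv/= => tD.
    by apply: icont (Qcl _ _ Qsy); exact: inr.
  - have [D00|Dn0] := eqVneq D 0.
      have /eqP : `|s - s0| + `|y - y0| = 0.
        by apply/eqP; move/eqP: D00; rewrite mulf_eq0 => /orP[/eqP|//]; lra.
      rewrite paddr_eq0 // !normr_eq0 !subr_eq0 => /andP[/eqP -> /eqP ->].
      by rewrite D00 subr0 addr0 minxx maxxx lexx.
    have Dp : 0 < D by rewrite lt_def Dn0.
    have lo : f i (t0 - D) s y < f i t0 s0 y0.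
      apply: imono; [apply: inr; lra| exact: Qcl |by rewrite subrr normr0|exact: closexx|].
      by apply: steep => //; [rewrite distrC (distrC y0) -/D; lra | lra].
    have hi : f i t0 s0 y0 < f i (t0 + D) s y.
      apply: imono; [by rewrite subrr normr0|exact: closexx|apply: inr; lra| exact: Qcl|].
      by apply: steep => //; [rewrite -/D; lra | lra].
    have lohi := lt_trans lo hi.
    by rewrite min_l ?max_r ?ltW.
  rewrite in_itv /= => /andP[t1 t2] ft; exists t => _; split => //.
  by rewrite ler_norml; apply/andP; split; lra.
have [u0 uP] := choice (fun z : R * R => ex z.1 z.2).
pose u s y := u0 (s, y).
have ub s y : Q s y -> `|u s y - t0| <= M * (`|s - s0| + `|y - y0|).
  by move=> /(uP (s, y))[].
have uf s y : Q s y -> f i (u s y) s y = f i t0 s0 y0.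
  by move=> /(uP (s, y))[].
have ur s y : Q s y -> `|u s y - t0| < r.
  by move=> Qsy; have /andP[_ ?] := QM _ _ Qsy; have := ub _ _ Qsy; lra.
(* Both ends have the same value of [f i], which would strictly increase along a segment whose
   [lean] exceeds [slack]. *)
have ulean s y s' y' : Q s y -> Q s' y' ->
    `|lean (u s y) s y (u s' y') s' y'| <= slack s y s' y'.
  move=> Qz Qz'; rewrite leNgt; apply/negP; rewrite ltr_normr => /orP[l|].
    have := imono _ _ _ _ _ _ (ur _ _ Qz) (Qcl _ _ Qz) (ur _ _ Qz') (Qcl _ _ Qz') l.
    by rewrite !uf // ltxx.
  rewrite -leanC -slackC => l.
  have := imono _ _ _ _ _ _ (ur _ _ Qz') (Qcl _ _ Qz') (ur _ _ Qz) (Qcl _ _ Qz) l.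
  by rewrite !uf // ltxx.
exists u; last first.
  have := ub _ _ Q0; rewrite !subrr !normr0 addr0 mulr0 normr_le0 subr_eq0.
  by move=> /eqP.
move=> s y Qz; have [sqz _ _] := Qb _ _ Qz; split.
- have := ub _ _ Qz; have /andP[_] := QM _ _ Qz.
  have := ler_normD (u s y - t0) t0; rewrite subrK; lra.
- by exists 1 => // s' y' Qz' _; exact: ulean.
move=> j jz.
(* In any other chart [j] the first integral is locally a function of [f i], hence also constant
   along the graph. *)
have [h [d d0 hd]] := fcompat (idom _ _ _ (ur _ _ Qz) (Qcl _ _ Qz)) jz.
have [e e0 he] := lean_small sqz d0.
exists (Num.min d e); first by rewrite lt_min d0.
move=> s' y' Qz' [sc yc].
rewrite !lt_min in sc yc; case/andP: sc => sd se; case/andP: yc => yd ye.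
have [sqz' _ _] := Qb _ _ Qz'.
rewrite hd //; last by apply: he (ulean _ _ _ _ Qz Qz').
rewrite hd ?subrr ?normr0 //; last exact: closexx.
by rewrite !uf.
Qed.

(** * Uniqueness and gluing of leaf graphs *)

Lemma leafy_near Q u s y (e : R) : (forall s y, Q s y -> in_square s y) ->
  leafy Q u -> Q s y -> 0 < e ->
  near_on Q s y (fun s' y' => `|u s' y' - u s y| < e).
Proof.
move=> Qsq uQ Qz e0; have [_ ul _] := uQ _ _ Qz.
have [d d0 dP] := lean_small (Qsq _ _ Qz) e0.
have {dP} : near_on Q s y (fun s' y' => forall t t',
    `|lean t s y t' s' y'| <= slack s y s' y' -> `|t' - t| < e).
  by exists d => // s' y' /Qsq ? ? t t'; exact: dP.
move=> /(near_onI ul); apply: near_on_sub => // s' y' _ [l]; exact.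
Qed.

(** Disagreement persists nearby by continuity. Agreement persists because both graphs then carry
    the same value of [f i], which is strictly increasing in [t]. *)
Lemma leafy_eq_near Q u1 u2 s y : (forall s y, Q s y -> in_square s y) ->
  leafy Q u1 -> leafy Q u2 -> Q s y ->
  near_on Q s y (fun s' y' => u1 s' y' = u2 s' y' <-> u1 s y = u2 s y).
Proof.
case: bounds => eps0 delta0 r0 M1 Mb.
move=> Qsq u1Q u2Q Qz; have [eq_u|neq_u] := eqVneq (u1 s y) (u2 s y); last first.
  have e0 : 0 < `|u1 s y - u2 s y| / 2 by rewrite divr_gt0 // normr_gt0 subr_eq0.
  apply: near_on_sub (near_onI (leafy_near Qsq u1Q Qz e0) (leafy_near Qsq u2Q Qz e0)) => //.
  move=> s' y' _ [h1 h2]; split => [eq_u|/eqP]; last by rewrite (negbTE neq_u).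
  move: h1 h2; rewrite eq_u => h1 h2; exfalso.
  have := ler_normB (u2 s' y' - u2 s y) (u2 s' y' - u1 s y).
  rewrite (_ : _ - _ - _ = u1 s y - u2 s y); last by ring.
  by lra.
have [ur _ u1f] := u1Q _ _ Qz; have [_ _ u2f] := u2Q _ _ Qz.
have [i [idom imono _]] := fcov ur (Qsq _ _ Qz).
have iz : dom i (u1 s y) s y by apply: idom; [rewrite subrr normr0|exact: closexx].
have c1 := near_onI (u1f i iz) (leafy_near Qsq u1Q Qz r0).
have iz2 : dom i (u2 s y) s y by rewrite -eq_u.
have c2 := near_onI (u2f i iz2) (leafy_near Qsq u2Q Qz r0).
have c3 : near_on Q s y (close r s y) by exists r.
apply: near_on_sub (near_onI c3 (near_onI c1 c2)) => // s' y' Qz'.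
rewrite -eq_u => -[zz' [[f1 n1] [f2 n2]]]; split => // _.
have nlt t t' : `|t - u1 s y| < r -> `|t' - u1 s y| < r ->
    f i t s' y' = f i t' s' y' -> ~ t < t'.
  move=> tr t'r ff tt'; have := @imono t s' y' t' s' y' tr zz' t'r zz'.
  rewrite ff ltxx /slack /lean !subrr !normr0 !mulr0 !addr0 subr_gt0.
  by move=> /(_ tt').
by have [l|l|//] := ltgtP (u1 s' y') (u2 s' y'); exfalso; apply: nlt l;
  rewrite -?eq_u // ?f1 ?f2 // eq_u.
Qed.

Definition seg (a a' x : R) := a + x * (a' - a).

(** Along the segment the agreement set is open and closed. The induction runs on the equivalence of
    agreement at two parameters, which is transitive. *)
Lemma leafy_unique Q u1 u2 s y s' y' : (forall s y, Q s y -> in_square s y) ->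
  leafy Q u1 -> leafy Q u2 ->
  (forall x, 0 <= x <= 1 -> Q (seg s s' x) (seg y y' x)) ->
  u1 s y = u2 s y -> u1 s' y' = u2 s' y'.
Proof.
case: bounds => eps0 delta0 r0 M1 Mb Qsq u1Q u2Q segQ.
pose e x := u1 (seg s s' x) (seg y y' x) = u2 (seg s s' x) (seg y y' x).
have : e 0 <-> e 1.
  apply: (@interval_induction _ (fun x x' => e x <-> e x')) => //.
    by move=> u v w _ _ [? ?] [? ?]; split; auto.
  move=> x x01; have [d d0 dP] := leafy_eq_near Qsq u1Q u2Q (segQ _ x01).
  (* [k] bounds both coordinate speeds of the segment; the summand 1 keeps it positive. *)
  pose k := 1 + `|s' - s| + `|y' - y|.
  have k0 : 0 < k by have := normr_ge0 (s' - s); have := normr_ge0 (y' - y); rewrite /k; lra.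
  exists (d / k); first by rewrite divr_gt0.
  have eP v : 0 <= v <= 1 -> `|v - x| < d / k -> e v <-> e x.
    move=> v01 vx; apply: dP; first exact: segQ.
    have vk a a' : `|a' - a| <= k -> `|seg a a' v - seg a a' x| < d.
      move=> ak; rewrite (_ : _ - _ = (v - x) * (a' - a)); last by rewrite /seg; ring.
      rewrite normrM (le_lt_trans (ler_wpM2l _ ak)) //.
      by rewrite -ltr_pdivlMr.
    by split; apply: vk; rewrite /k;
      have := normr_ge0 (s' - s); have := normr_ge0 (y' - y); lra.
  move: x01 => /andP[x0 x1] v w v0 w1 v1 vx xw w2.
  have := eP v ltac:(apply/andP; split; lra) ltac:(rewrite ltr_norml; apply/andP; split; lra).
  have := eP w ltac:(apply/andP; split; lra) ltac:(rewrite ltr_norml; apply/andP; split; lra).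
  by move=> [? ?] [? ?]; split; auto.
by rewrite /e /seg !mul0r !addr0 !mul1r !(addrC s) !(addrC y) !subrK => -[].
Qed.

Definition closed_on Q := forall s y, ~ Q s y -> near_on (fun _ _ => True) s y
  (fun s' y' => ~ Q s' y').

(** Being leafy is a local condition, and relative to a union it splits into one condition for each
    piece. Closedness makes the condition for a piece vacuous near a point outside it. *)
Lemma leafy_glue Q1 Q2 u1 u2 : closed_on Q1 -> closed_on Q2 ->
  leafy Q1 u1 -> leafy Q2 u2 ->
  (forall s y, Q1 s y -> Q2 s y -> u1 s y = u2 s y) ->
  exists2 u, leafy (fun s y => Q1 s y \/ Q2 s y) u &
    (forall s y, Q1 s y -> u s y = u1 s y) /\ (forall s y, Q2 s y -> u s y = u2 s y).
Proof.
move=> cQ1 cQ2 u1Q u2Q u12.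
pose u s y := if `[<Q1 s y>] then u1 s y else u2 s y.
have uu1 s y : Q1 s y -> u s y = u1 s y by rewrite /u; case: asboolP.
have uu2 s y : Q2 s y -> u s y = u2 s y.
  by rewrite /u; case: asboolP => // q1 q2; exact: u12.
have loc Q u' (A : R -> R -> R -> R -> R -> R -> Prop) s y :
    closed_on Q -> (forall s y, Q s y -> u s y = u' s y) ->
    (Q s y -> near_on Q s y (fun s' y' => A (u' s y) s y (u' s' y') s' y')) ->
    near_on Q s y (fun s' y' => A (u s y) s y (u s' y') s' y').
  move=> cQ uu' nA; have [Qz|nQz] := pselect (Q s y).
    by apply: near_on_sub (nA Qz) => // s' y' Qz'; rewrite !uu'.
  by apply: near_on_sub (cQ _ _ nQz).
exists u => // s y Qz; split.
- by case: Qz => Qz; [rewrite uu1 //; have [] := u1Q _ _ Qz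
                     |rewrite uu2 //; have [] := u2Q _ _ Qz].
- apply: near_onU.
    apply: (loc Q1 u1 (fun t s y t' s' y' => `|lean t s y t' s' y'| <= slack s y s' y')) => // Q1z.
    by have [] := u1Q _ _ Q1z.
  apply: (loc Q2 u2 (fun t s y t' s' y' => `|lean t s y t' s' y'| <= slack s y s' y')) => // Q2z.
  by have [] := u2Q _ _ Q2z.
- move=> i iz; apply: near_onU.
    apply: (loc Q1 u1 (fun t s y t' s' y' => f i t' s' y' = f i t s y)) => // Q1z.
    by have [_ _] := u1Q _ _ Q1z; apply; rewrite -uu1.
  apply: (loc Q2 u2 (fun t s y t' s' y' => f i t' s' y' = f i t s y)) => // Q2z.
  by have [_ _] := u2Q _ _ Q2z; apply; rewrite -uu2.
Qed.

(** With [y] constant the integral of the contact form is additive along the edge and [slack] is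
    linear in the length, so the local bounds add up. *)
Lemma leafy_edge_s Q u y s1 s2 : leafy Q u -> s1 <= s2 ->
  (forall s, s1 <= s <= s2 -> Q s y) ->
  `|u s2 y - u s1 y + (b + y) * (s2 - s1)| <= eps * (s2 - s1).
Proof.
move=> uQ s12 Qs.
apply: (@interval_induction _ (fun v w =>
  `|u w y - u v y + (b + y) * (w - v)| <= eps * (w - v))) => //.
  move=> s s' s'' _ _ h1 h2.
  rewrite (_ : _ + _ = (u s'' y - u s' y + (b + y) * (s'' - s')) +
    (u s' y - u s y + (b + y) * (s' - s))); last by ring.
  by rewrite (le_trans (ler_normD _ _)) //; lra.
move=> x xs; have [_ [d d0 dP] _] := uQ _ _ (Qs _ xs); exists d => //.
move=> v w sv ws xv vx xw wx; move/andP: xs => [sx xs].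
have := dP v y ltac:(apply: Qs; apply/andP; split; lra)
  ltac:(by split; [rewrite ltr_norml; apply/andP; split; lra|rewrite subrr normr0]).
have := dP w y ltac:(apply: Qs; apply/andP; split; lra)
  ltac:(by split; [rewrite ltr_norml; apply/andP; split; lra|rewrite subrr normr0]).
rewrite /lean /slack !subrr !normr0 !addr0 !mulr0 !addr0.
rewrite (_ : (y + y) / 2 = y); last by field.
rewrite (@ger0_norm _ (w - x)) ?(@ler0_norm _ (v - x)); [|lra|lra].
move=> h1 h2.
rewrite (_ : _ + _ = (u w y - u x y + (b + y) * (w - x)) -
    (u v y - u x y + (b + y) * (v - x))); last by ring.
by rewrite (le_trans (ler_normB _ _)) //; lra.
Qed.

(** With [s] constant the contact form reduces to [dt]. *)
Lemma leafy_edge_y Q u s y1 y2 : leafy Q u -> y1 <= y2 ->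
  (forall y, y1 <= y <= y2 -> Q s y) ->
  `|u s y2 - u s y1| <= eps * (y2 - y1).
Proof.
move=> uQ y12 Qs.
apply: (@interval_induction _ (fun v w => `|u s w - u s v| <= eps * (w - v))) => //.
  move=> y y' y'' _ _ h1 h2; rewrite (le_trans (ler_distD (u s y') _ _)) //; lra.
move=> x xs; have [_ [d d0 dP] _] := uQ _ _ (Qs _ xs); exists d => //.
move=> v w sv ws xv vx xw wx; move/andP: xs => [sx xs].
have := dP s v ltac:(apply: Qs; apply/andP; split; lra)
  ltac:(by split; [rewrite subrr normr0|rewrite ltr_norml; apply/andP; split; lra]).
have := dP s w ltac:(apply: Qs; apply/andP; split; lra)
  ltac:(by split; [rewrite subrr normr0|rewrite ltr_norml; apply/andP; split; lra]).
rewrite /lean /slack !subrr !normr0 !mulr0 !addr0 !add0r.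
rewrite (@ger0_norm _ (w - x)) ?(@ler0_norm _ (v - x)); [|lra|lra].
move=> h1; rewrite distrC => h2.
by rewrite (le_trans (ler_distD (u s x) _ _)) //; lra.
Qed.

(** The lift over [Q1] is continued over [Q2] from its height at [(s1, y1)], at distance at most [k]
    from [t0]. The overlap is star-shaped about that point, so uniqueness along segments gives the
    agreement needed for gluing. *)
Lemma leafy_union Q1 Q2 s0 y0 s1 y1 t0 k :
  closed_on Q1 -> closed_on Q2 ->
  (forall s y, Q1 s y -> in_square s y) -> (forall s y, Q2 s y -> in_square s y) ->
  Q1 s0 y0 -> Q1 s1 y1 -> Q2 s1 y1 ->
  (forall s y x, Q1 s y -> Q2 s y -> 0 <= x <= 1 ->
     Q1 (seg s1 s x) (seg y1 y x) /\ Q2 (seg s1 s x) (seg y1 y x)) ->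
  (forall u, leafy Q1 u -> `|u s1 y1 - u s0 y0| <= k) ->
  (exists2 u, leafy Q1 u & u s0 y0 = t0) ->
  (forall t1, `|t1| <= `|t0| + k -> exists2 u, leafy Q2 u & u s1 y1 = t1) ->
  exists2 u, leafy (fun s y => Q1 s y \/ Q2 s y) u & u s0 y0 = t0.
Proof.
move=> cQ1 cQ2 sq1 sq2 Q1z0 Q1z1 Q2z1 segQ uk [u1 u1Q u1z] ex2.
have [|u2 u2Q u2z] := ex2 (u1 s1 y1).
  have := uk _ u1Q; rewrite u1z => h.
  by rewrite -[u1 s1 y1](subrK t0) (le_trans (ler_normD _ _)) //; lra.
have [|u uQ [uu1 _]] := leafy_glue cQ1 cQ2 u1Q u2Q; last first.
  by exists u => //; rewrite uu1.
move=> s y Q1z Q2z.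
apply: (@leafy_unique (fun s y => Q1 s y /\ Q2 s y) u1 u2 s1 y1) => //.
- by move=> s' y' [/sq1].
- by apply: leafy_sub u1Q => ? ? [].
- by apply: leafy_sub u2Q => ? ? [].
- by move=> x; exact: segQ.
Qed.

(** * Lifting rectangles by doubling *)

Definition rect (a w c v s y : R) := a <= s <= a + w /\ c <= y <= c + v.

Lemma closed_rect a w c v : closed_on (rect a w c v).
Proof.
move=> s y nz.
have gap e : 0 < e ->
    (forall s' y', rect a w c v s' y' -> close e s y s' y' -> False) ->
    near_on (fun _ _ => True) s y (fun s' y' => ~ rect a w c v s' y').
  by move=> e0 h; exists e => // s' y' _ zz' Rz'; exact: h zz'.
have abs (e x x' : R) : `|x' - x| < e -> x - e < x' < x + e.
  by rewrite ltr_norml => /andP[? ?]; apply/andP; split; lra.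
have [h1|h1] := ltP s a.
  apply: (gap (a - s)) => //; first by lra.
  by move=> s' y' [/andP[? ?] _] [/abs/andP[? ?] _]; lra.
have [h2|h2] := ltP (a + w) s.
  apply: (gap (s - (a + w))) => //; first by lra.
  by move=> s' y' [/andP[? ?] _] [/abs/andP[? ?] _]; lra.
have [h3|h3] := ltP y c.
  apply: (gap (c - y)) => //; first by lra.
  by move=> s' y' [_ /andP[? ?]] [_ /abs/andP[? ?]]; lra.
have [h4|h4] := ltP (c + v) y.
  apply: (gap (y - (c + v))) => //; first by lra.
  by move=> s' y' [_ /andP[? ?]] [_ /abs/andP[? ?]]; lra.
by case: nz; split; apply/andP.
Qed.

Lemma seg_between a a' x lo hi : 0 <= x <= 1 -> lo <= a <= hi ->
  lo <= a' <= hi -> lo <= seg a a' x <= hi.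
Proof.
move=> /andP[x0 x1] /andP[? ?] /andP[? ?]; rewrite /seg; apply/andP; split; nra.
Qed.

Lemma rect_seg a w c v s y s' y' x : 0 <= x <= 1 -> rect a w c v s y ->
  rect a w c v s' y' -> rect a w c v (seg s s' x) (seg y y' x).
Proof. by move=> x01 [? ?] [? ?]; split; exact: seg_between. Qed.

(** The contact form has slope at most [|b| + delta], the edge estimate adds [eps], and [M] exceeds
    the sum. *)
Lemma leafy_lip_s Q u s s' y : (forall s y, Q s y -> in_square s y) ->
  leafy Q u -> (forall x, 0 <= x <= 1 -> Q (seg s s' x) y) ->
  `|u s' y - u s y| <= M * `|s' - s|.
Proof.
case: bounds => eps0 delta0 r0 M1 Mb Qsq uQ segQ.
wlog ss' : s s' segQ / s < s' => [hw|].
  have [/hw|/hw|->] := ltgtP s s'; [exact| |by rewrite !subrr normr0 mulr0].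
  rewrite distrC (distrC s); apply=> x /andP[x0 x1].
  rewrite (_ : seg _ _ _ = seg s s' (1 - x)); last by rewrite /seg; ring.
  by apply: segQ; apply/andP; split; lra.
have Qs x : s <= x <= s' -> Q x y.
  move=> /andP[sx xs']; have d0 : 0 < s' - s by lra.
  rewrite (_ : x = seg s s' ((x - s) / (s' - s))).
    by apply: segQ; rewrite divr_ge0 ?ler_pdivrMr //=; lra.
  by rewrite /seg divfK ?gt_eqF //; lra.
have [_ /andP[y0 yd]] := Qsq _ _ (Qs s ltac:(apply/andP; split; lra)).
have := leafy_edge_s uQ (ltW ss') Qs.
rewrite (@ger0_norm _ (s' - s)); last by lra.
set D := s' - s; have D0 : 0 < D by rewrite /D; lra.
have : `|(b + y) * D| <= (`|b| + delta) * D.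
  rewrite normrM (@gtr0_norm _ D) //; apply: ler_wpM2r; first exact: ltW.
  by rewrite (le_trans (ler_normD _ _)) // lerD2l ger0_norm.
have : (`|b| + delta + eps) * D <= M * D by rewrite ler_wpM2r; lra.
move=> h1 h2 h3; rewrite (_ : _ - _ = (u s' y - u s y + (b + y) * D) - (b + y) * D); last by ring.
by rewrite (le_trans (ler_normB _ _)) //; lra.
Qed.

Lemma leafy_lip_y Q u s y y' : leafy Q u ->
  (forall x, 0 <= x <= 1 -> Q s (seg y y' x)) ->
  `|u s y' - u s y| <= M * `|y' - y|.
Proof.
case: bounds => eps0 delta0 r0 M1 Mb uQ segQ.
wlog yy' : y y' segQ / y < y' => [hw|].
  have [/hw|/hw|->] := ltgtP y y'; [exact| |by rewrite !subrr normr0 mulr0].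
  rewrite distrC (distrC y); apply=> x /andP[x0 x1].
  rewrite (_ : seg _ _ _ = seg y y' (1 - x)); last by rewrite /seg; ring.
  by apply: segQ; apply/andP; split; lra.
have Qs x : y <= x <= y' -> Q s x.
  move=> /andP[sx xs']; have d0 : 0 < y' - y by lra.
  rewrite (_ : x = seg y y' ((x - y) / (y' - y))).
    by apply: segQ; rewrite divr_ge0 ?ler_pdivrMr //=; lra.
  by rewrite /seg divfK ?gt_eqF //; lra.
have := leafy_edge_y uQ (ltW yy') Qs.
rewrite (@ger0_norm _ (y' - y)); last by lra.
move=> h; rewrite (le_trans h) //; apply: ler_wpM2r; first by lra.
by have := normr_ge0 b; lra.
Qed.

(** The budget [M * (w + v)] allows for the change of height over the rectangle, keeping the leaf
    where charts are available. The base point is arbitrary, so that a lift can be continued from a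
    common edge. *)
Definition liftable (w v : R) := forall a c s0 y0 t0,
  (forall s y, rect a w c v s y -> in_square s y) -> rect a w c v s0 y0 ->
  `|t0| + M * (w + v) <= rho ->
  exists2 u, leafy (rect a w c v) u & u s0 y0 = t0.

Lemma liftable_small w v : 0 <= w -> 0 <= v -> M * (w + v) < r -> liftable w v.
Proof.
move=> w0 v0 Mr a c s0 y0 t0 sq Rz trho.
apply: leafy_lift Mr => //; first exact: sq.
move=> s y Rz'; split; first exact: sq.
  case: Rz Rz' => /andP[? ?] _ [/andP[? ?] _].
  by rewrite ler_norml; apply/andP; split; lra.
case: Rz Rz' => _ /andP[? ?] [_ /andP[? ?]].
by rewrite ler_norml; apply/andP; split; lra.
Qed.

(** The halves meet along [s = a + w]. Reaching that line from the base point costs at most [M * w],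
    exactly the excess of the budget of the whole over that of one half. *)
Lemma liftable_double_s w v : 0 <= w -> 0 <= v ->
  liftable w v -> liftable (w + w) v.
Proof.
case: bounds => eps0 delta0 r0 M1 Mb w0 v0 L a c s0 y0 t0 sq Rz trho.
pose Q1 := rect a w c v; pose Q2 := rect (a + w) w c v.
have Q1R s y : Q1 s y -> rect a (w + w) c v s y.
  by move=> [/andP[? ?] ?]; split => //; apply/andP; split; lra.
have Q2R s y : Q2 s y -> rect a (w + w) c v s y.
  by move=> [/andP[? ?] ?]; split => //; apply/andP; split; lra.
have sq1 s y : Q1 s y -> in_square s y by move=> /Q1R; exact: sq.
have sq2 s y : Q2 s y -> in_square s y by move=> /Q2R; exact: sq.
have [/andP[as0 s0w] yc] := Rz.
have Mw : 0 <= M * w by rewrite mulr_ge0 //; lra.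
have Q1z1 : Q1 (a + w) y0 by split => //; apply/andP; split; lra.
have Q2z1 : Q2 (a + w) y0 by split => //; apply/andP; split; lra.
have [s0a|s0a] := leP s0 (a + w).
  have Q1z0 : Q1 s0 y0 by split => //; apply/andP; split; lra.
  have [||||u uQ uz] := @leafy_union Q1 Q2 s0 y0 (a + w) y0 t0 (M * w)
    (@closed_rect _ _ _ _) (@closed_rect _ _ _ _) sq1 sq2 Q1z0 Q1z1 Q2z1.
  - by move=> s y x ? ? ?; split; exact: rect_seg.
  - move=> u uQ; have := @leafy_lip_s _ u s0 (a + w) y0 sq1 uQ.
    move=> /(_ _)/le_trans-> //.
      move=> x x01; rewrite (_ : y0 = seg y0 y0 x) ?/seg ?subrr ?mulr0 ?addr0 //.
      by have := rect_seg x01 Q1z0 Q1z1; rewrite /seg subrr mulr0 addr0.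
    rewrite ler_wpM2l //; first by lra.
    by rewrite ler_norml; apply/andP; split; lra.
  - by apply: L => //; lra.
  - by move=> t1 t1k; apply: L => //; lra.
  exists u => //; apply: leafy_sub uQ => s y [/andP[? ?] ?].
  by have [?|?] := leP s (a + w); [left|right]; split => //; apply/andP; split; lra.
have Q2z0 : Q2 s0 y0 by split => //; apply/andP; split; lra.
have [||||u uQ uz] := @leafy_union Q2 Q1 s0 y0 (a + w) y0 t0 (M * w)
  (@closed_rect _ _ _ _) (@closed_rect _ _ _ _) sq2 sq1 Q2z0 Q2z1 Q1z1.
- by move=> s y x ? ? ?; split; exact: rect_seg.
- move=> u uQ; have := @leafy_lip_s _ u s0 (a + w) y0 sq2 uQ.
  move=> /(_ _)/le_trans-> //.
    move=> x x01.
    by have := rect_seg x01 Q2z0 Q2z1; rewrite {2}/seg subrr mulr0 addr0.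
  rewrite ler_wpM2l //; first by lra.
  by rewrite ler_norml; apply/andP; split; lra.
- by apply: L => //; lra.
- by move=> t1 t1k; apply: L => //; lra.
exists u => //; apply: leafy_sub uQ => s y [/andP[? ?] ?].
by have [?|?] := leP s (a + w); [right|left]; split => //; apply/andP; split; lra.
Qed.

Lemma liftable_double_y w v : 0 <= w -> 0 <= v ->
  liftable w v -> liftable w (v + v).
Proof.
case: bounds => eps0 delta0 r0 M1 Mb w0 v0 L a c s0 y0 t0 sq Rz trho.
pose Q1 := rect a w c v; pose Q2 := rect a w (c + v) v.
have Q1R s y : Q1 s y -> rect a w c (v + v) s y.
  by move=> [? /andP[? ?]]; split => //; apply/andP; split; lra.
have Q2R s y : Q2 s y -> rect a w c (v + v) s y.
  by move=> [? /andP[? ?]]; split => //; apply/andP; split; lra.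
have sq1 s y : Q1 s y -> in_square s y by move=> /Q1R; exact: sq.
have sq2 s y : Q2 s y -> in_square s y by move=> /Q2R; exact: sq.
have [sa /andP[cy0 y0v]] := Rz.
have Mv : 0 <= M * v by rewrite mulr_ge0 //; lra.
have Q1z1 : Q1 s0 (c + v) by split => //; apply/andP; split; lra.
have Q2z1 : Q2 s0 (c + v) by split => //; apply/andP; split; lra.
have [y0c|y0c] := leP y0 (c + v).
  have Q1z0 : Q1 s0 y0 by split => //; apply/andP; split; lra.
  have [||||u uQ uz] := @leafy_union Q1 Q2 s0 y0 s0 (c + v) t0 (M * v)
    (@closed_rect _ _ _ _) (@closed_rect _ _ _ _) sq1 sq2 Q1z0 Q1z1 Q2z1.
  - by move=> s y x ? ? ?; split; exact: rect_seg.
  - move=> u uQ; have := @leafy_lip_y _ u s0 y0 (c + v) uQ.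
    move=> /(_ _)/le_trans-> //.
      move=> x x01.
      by have := rect_seg x01 Q1z0 Q1z1; rewrite {1}/seg subrr mulr0 addr0.
    rewrite ler_wpM2l //; first by lra.
    by rewrite ler_norml; apply/andP; split; lra.
  - by apply: L => //; lra.
  - by move=> t1 t1k; apply: L => //; lra.
  exists u => //; apply: leafy_sub uQ => s y [? /andP[? ?]].
  by have [?|?] := leP y (c + v); [left|right]; split => //; apply/andP; split; lra.
have Q2z0 : Q2 s0 y0 by split => //; apply/andP; split; lra.
have [||||u uQ uz] := @leafy_union Q2 Q1 s0 y0 s0 (c + v) t0 (M * v)
  (@closed_rect _ _ _ _) (@closed_rect _ _ _ _) sq2 sq1 Q2z0 Q2z1 Q1z1.
- by move=> s y x ? ? ?; split; exact: rect_seg.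
- move=> u uQ; have := @leafy_lip_y _ u s0 y0 (c + v) uQ.
  move=> /(_ _)/le_trans-> //.
    move=> x x01.
    by have := rect_seg x01 Q2z0 Q2z1; rewrite {1}/seg subrr mulr0 addr0.
  rewrite ler_wpM2l //; first by lra.
  by rewrite ler_norml; apply/andP; split; lra.
- by apply: L => //; lra.
- by move=> t1 t1k; apply: L => //; lra.
exists u => //; apply: leafy_sub uQ => s y [? /andP[? ?]].
by have [?|?] := leP y (c + v); [right|left]; split => //; apply/andP; split; lra.
Qed.

(** Halving [N] times makes the pieces small enough for one chart; doubling [N] times in each
    direction recovers the square. *)
Lemma liftable_delta : liftable delta delta.
Proof.
case: bounds => eps0 delta0 r0 M1 Mb.
pose N := Num.bound (M * (delta + delta) / r); pose w := delta / 2 ^+ N.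
have p0 k : 0 < 2 ^+ k :> R by rewrite exprn_gt0.
have w0 : 0 <= w by rewrite divr_ge0 ?ltW.
have wN : 2 ^+ N * w = delta by rewrite /w mulrC divfK // gt_eqF.
have L0 : liftable w w.
  apply: liftable_small => //.
  rewrite -(ltr_pM2l (p0 N)) mulrCA mulrDr wN.
  rewrite -ltr_pdivrMr //; apply: lt_trans (archi_boundP _) _.
    by rewrite divr_ge0 ?ltW // mulr_gt0; lra.
  by rewrite -natrX ltr_nat ltn_expl.
have Ls k : liftable (2 ^+ k * w) w.
  elim: k => [|k IH]; first by rewrite expr0 mul1r.
  rewrite exprS mulrDl mul1r mulrDl; apply: liftable_double_s => //.
  by rewrite mulr_ge0 // ltW.
have Ly k : liftable (2 ^+ N * w) (2 ^+ k * w).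
  elim: k => [|k IH]; first by rewrite expr0 mul1r.
  rewrite exprS mulrDl mul1r mulrDl; apply: liftable_double_y => //.
    by rewrite mulr_ge0 // ltW.
  by rewrite mulr_ge0 // ltW.
by have := Ly N; rewrite wN.
Qed.

(* The contact form integrates to [delta ^+ 2] around the boundary of the
   square lifted to a leaf, while each edge contributes at most
   [eps * delta]. *)
Lemma square_bound : 2 * M * delta <= rho -> delta <= 4 * eps.
Proof.
move=> Mrho; case: (bounds) => eps0 delta0 r0 M1 Mb.
have dd : 0 <= delta <= delta by apply/andP; split; lra.
have d0 : 0 <= (0 : R) <= delta by apply/andP; split; lra.
have [|||u uQ _] := @liftable_delta 0 0 0 0 0.
- by move=> s y; rewrite /rect !add0r.
- by rewrite /rect !add0r.
- by rewrite normr0; lra.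
have Rz s y : 0 <= s <= delta -> 0 <= y <= delta -> rect 0 delta 0 delta s y.
  by rewrite /rect !add0r.
have := leafy_edge_s uQ (ltW delta0) (fun s sd => Rz s 0 sd d0).
have := leafy_edge_s uQ (ltW delta0) (fun s sd => Rz s delta sd dd).
have := leafy_edge_y uQ (ltW delta0) (fun y yd => Rz 0 y d0 yd).
have := leafy_edge_y uQ (ltW delta0) (fun y yd => Rz delta y dd yd).
rewrite !ler_norml !subr0 addr0 => /andP[? ?] /andP[? ?] /andP[? ?] /andP[? ?].
have : delta * delta <= (4 * eps) * delta by lra.
by rewrite ler_pM2r.
Qed.
End LeafGraphs.

(** * Directional derivatives *)

Section DirectionalDerivatives.
Context {R : realType} {V : normedModType R}.
Implicit Types (f : V -> R) (x w : V).

Lemma is_derive_line f x w (t df : R) : is_derive (x + t *: w) w f df ->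
  is_derive t 1 (fun t => f (x + t *: w)) df.
Proof.
move=> [dv <-].
have E : (fun h : R => h^-1 *: (((fun t => f (x + t *: w)) \o shift t) (h *: (1 : R)) -
      f (x + t *: w))) =
    (fun h => h^-1 *: ((f \o shift (x + t *: w)) (h *: w) - f (x + t *: w))).
  apply/funext => h /=; congr (_ *: (f _ - _)).
  by rewrite scalerDl /GRing.scale /= mulr1 addrCA.
by split; rewrite /derivable /derive E.
Qed.

(** The step [a] may have either sign, so the intermediate point is located by [|xi| <= |a|]. *)
Lemma mean_value_dir f (df : V -> R) x w (a : R) :
  (forall xi, `|xi| <= `|a| -> is_derive (x + xi *: w) w f (df (x + xi *: w))) ->
  exists2 xi, `|xi| <= `|a| & f (x + a *: w) - f x = a * df (x + xi *: w).
Proof.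
move=> fd.
have fl (xi : R) : `|xi| <= `|a| ->
    is_derive xi 1 (fun t => f (x + t *: w)) (df (x + xi *: w)).
  by move=> /fd /is_derive_line.
have mvt (c d : R) : c <= d -> (forall xi, c <= xi <= d -> `|xi| <= `|a|) ->
    exists2 xi, `|xi| <= `|a| &
      f (x + d *: w) - f (x + c *: w) = df (x + xi *: w) * (d - c).
  move=> cd cda; have [||xi cxi E] := @MVT_segment R (fun t => f (x + t *: w))
    (fun t => df (x + t *: w)) c d cd.
  - by move=> xi xicd; apply/fl/cda; rewrite !ltW ?(itvP xicd).
  - apply: derivable_within_continuous => t tcd.
    by move: (tcd); rewrite in_itv /= => /cda /fl [].
  by exists xi => //; apply: cda; move: cxi; rewrite in_itv.
have [a0|a0] := leP 0 a.
  have [|xi xia E] := mvt 0 a a0.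
    by move=> xi /andP[? ?]; rewrite !ger0_norm.
  by exists xi => //; rewrite scale0r addr0 subr0 mulrC in E.
have [|xi xia E] := mvt a 0 (ltW a0).
  by move=> xi /andP[? ?]; rewrite !ler0_norm ?lerN2 // ltW.
exists xi => //; rewrite scale0r addr0 sub0r in E.
by rewrite -opprB E mulrN opprK mulrC.
Qed.

(** The increment is split into a step along [w1] followed by one along [w2]. By the mean value
    theorem the second is governed by a value of ['D_w2 f] near [x], and continuity gives its
    limit. *)
Lemma is_deriveDr f x w1 w2 (k d1 : R) : is_derive x w1 f d1 ->
  (\forall y \near x, derivable f y w2) ->
  {for x, continuous (fun y => 'D_w2 f y)} ->
  is_derive x (w1 + k *: w2) f (d1 + k * 'D_w2 f x).
Proof.
move=> [dv1 dv1E] dv2 ct2.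
have c1 : (fun h => h^-1 *: ((f \o shift x) (h *: w1) - f x)) @ 0^' --> d1.
  by rewrite -dv1E; exact: dv1.
suff c : (fun h => h^-1 *: ((f \o shift x) (h *: (w1 + k *: w2)) - f x)) @ 0^'
    --> d1 + k * 'D_w2 f x.
  by split; [exact: cvgP c | exact: cvg_lim c].
have -> : (fun h => h^-1 *: ((f \o shift x) (h *: (w1 + k *: w2)) - f x)) =
    (fun h => h^-1 *: ((f \o shift x) (h *: w1) - f x) +
      h^-1 * (f (x + h *: w1 + (h * k) *: w2) - f (x + h *: w1))).
  apply/funext => h /=; rewrite (scalerDr h) (scalerA h) [_ + x]addrC addrA.
  by rewrite [_ + x]addrC -[LHS]/(_ * _) -[h^-1 *: _]/(_ * _); ring.
apply: cvgD => //.
apply/cvgrPdist_le => e e0.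
have k1 : 0 < `|k| + 1 by rewrite ltr_wpDl.
have : \forall y \near x, derivable f y w2 /\
    `|'D_w2 f x - 'D_w2 f y| < e / (`|k| + 1).
  near=> y; split; first by near: y.
  by near: y; move/cvgrPdist_lt : ct2; apply; rewrite divr_gt0.
move=> /nbhs_ballP[rad /= rad0 radP].
(* [|h| * B] bounds the distance from [x] of all points of the second step; the summand 1 keeps [B]
   positive. *)
pose B := `|w1| + `|k| * `|w2| + 1.
have B0 : 0 < B by rewrite ltr_wpDl // addr_ge0 // mulr_ge0.
near=> h.
have h0 : h != 0 by near: h; exact: nbhs_dnbhs_neq.
have hB : `|h| * B < rad.
  rewrite -ltr_pdivlMr //; near: h; apply: dnbhs0_lt; exact: divr_gt0.
have inb (xi : R) : `|xi| <= `|h * k| -> ball x rad (x + h *: w1 + xi *: w2).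
  move=> xih; rewrite -ball_normE /= opprD addrA opprD addrA subrr sub0r.
  rewrite -opprD normrN (le_lt_trans _ hB) // (le_trans (ler_normD _ _)) //.
  rewrite !normrZ /B !mulrDr mulr1 mulrA -[leLHS]addr0 lerD // lerD2l.
  by rewrite ler_wpM2r // -normrM.
have [|xi xih ->] := @mean_value_dir f (fun y => 'D_w2 f y) (x + h *: w1) w2 (h * k).
  by move=> xi /inb /radP[dy _]; exact: DeriveDef.
rewrite -mulrA mulKf // -mulrBr normrM.
have [_ /ltW le] := radP _ (inb _ xih).
rewrite (le_trans (ler_wpM2l _ le)) // mulrCA ger_pMr //.
by rewrite ler_pdivrMr // mul1r lerDl.
Unshelve. all: by end_near.
Qed.

End DirectionalDerivatives.

(** * Curvature of the metric *)

Section GcGeometry.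
Context {R : realType}.
Implicit Types (c z : R) (m : nat).

(** * The orthonormal coframe *)

(** Row [i] holds the components of the [i]-th coordinate vector in the frame, so
    [v *m coframe3 c x] is the row of frame components of [v]. *)
Definition coframe3 c (x : 'rV[R]_3) : 'M[R]_3 :=
  \matrix_(i < 3) match val i with
    | 0 => c *: delta_mx 0 0
    | 1 => (c * x 0 2%:R) *: delta_mx 0 0 + delta_mx 0 1
    | _ => delta_mx 0 2%:R
    end.

Lemma invmx_frame3 c x : c != 0 -> invmx (frame3 c x) = coframe3 c x.
Proof.
move=> c0; have fu := frame3_unit x c0.
suff E : frame3 c x *m coframe3 c x = 1%:M.
  by rewrite -[LHS]mulmx1 -E mulKmx.
apply/matrixP => i j; rewrite !mxE !big_ord_recl big_ord0 !mxE.
by case: i => [[|[|[|//]]] ?]; case: j => [[|[|[|//]]] ?]; rewrite /= !mxE /= ?mulr0 ?mulr1 ?mul0r ?addr0 ?add0r ?subr0; field.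
Qed.

Definition coframe c m (x : 'rV[R]_(3 + m)) : 'M[R]_(3 + m) :=
  block_mx (coframe3 c (lsubmx x)) 0 0 1%:M.

Definition gc_sign m : 'rV[R]_(3 + m) := row_mx (\row_i if i == 0 then -1 else 1) (const_mx 1).

Lemma gcE c m x : c != 0 ->
  gc c m x = coframe c x *m diag_mx (gc_sign m) *m (coframe c x)^T.
Proof.
move=> c0; rewrite /gc /g3 invmx_frame3 // /coframe /gc_sign diag_mx_row.
rewrite tr_block_mx !mulmx_block !trmx0 !mul0mx !mulmx0 !addr0 !add0r trmx1.
by rewrite diag_const_mx !mulmx1 !mul0mx.
Qed.

Lemma coframe_unit c m x : c != 0 -> @coframe c m x \in unitmx.
Proof.
move=> c0; rewrite unitmxE /coframe det_ublock det1 mulr1 -unitmxE.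
by rewrite -invmx_frame3 // unitmx_inv frame3_unit.
Qed.

Definition diag_eval m (d w : 'rV[R]_m) := \sum_i d 0 i * w 0 i ^+ 2.

Lemma mul_diag_eval m (d w : 'rV[R]_m) :
  (w *m diag_mx d *m w^T) 0 0 = diag_eval d w.
Proof.
rewrite mul_mx_diag mxE; apply: eq_bigr => i _; rewrite !mxE.
by rewrite mulrAC mulrC expr2.
Qed.

Lemma gc_eval c m x v : c != 0 ->
  tensor_eval (gc c m) x v v = diag_eval (gc_sign m) (v *m coframe c x).
Proof.
by move=> c0; rewrite -mul_diag_eval /tensor_eval gcE // trmx_mul !mulmxA.
Qed.

Definition slice_dir m (i : 'I_3) : 'rV[R]_(3 + m) := delta_mx 0 (lshift m i).

(** The frame components of [v] are [c * (t + x_2 * s)], [s] and [y]: the contact form enters scaled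
    by [c]. *)
Lemma gc_eval3 c m x (t s y : R) : c != 0 ->
  let v := t *: slice_dir m 0 + s *: slice_dir m 1 + y *: slice_dir m 2%:R in
  tensor_eval (gc c m) x v v =
    - (c * (t + x 0 (lshift m 2%:R) * s)) ^+ 2 + s ^+ 2 + y ^+ 2.
Proof.
move=> c0 v; rewrite gc_eval //.
have -> : v = row_mx (t *: delta_mx 0 0 + s *: delta_mx 0 1 + y *: delta_mx 0 2%:R) 0.
  apply/rowP => i; rewrite !mxE; case: (split_ordP i) => i' ->; rewrite !mxE /=.
    by rewrite !(inj_eq (@lshift_inj _ _)).
  by rewrite !mulr0 !addr0.
rewrite /coframe mul_row_block !mul0mx !mulmx0 !addr0 /diag_eval big_split_ord /=.
rewrite [X in _ + X]big1 ?addr0 => [|j _]; last by rewrite !row_mxEr !mxE expr0n mulr0.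
rewrite !big_ord_recl big_ord0 !row_mxEl !mxE /= !big_ord_recl !big_ord0 !mxE /=.
by ring.
Qed.

(* The metric, its inverse and the Christoffel symbols are polynomials of degree
   at most two in the coordinate [x_2]; [(a, b, e)] stands for
   [a + b x_2 + e x_2^2]. *)
Definition quad (q : R * R * R) (z : R) := q.1.1 + q.1.2 * z + q.2 * z ^+ 2.
Definition dquad (q : R * R * R) (z : R) := q.1.2 + 2 * q.2 * z.

Lemma partial_quad m (q : R * R * R) (i : 'I_(3 + m)) x :
  partial i (fun x => quad q (x 0 (lshift m 2%:R))) x =
  if val i == 2%N then dquad q (x 0 (lshift m 2%:R)) else 0.
Proof.
(* [k] is the rate at which [x_2] changes along the [i]-th basis vector, which reduces the claim to
   one variable. *)
set z := x 0 _; pose k : R := (val i == 2%N)%:R.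
have E : partial i (fun x => quad q (x 0 (lshift m 2%:R))) x =
    'D_(1 : R) (fun h : R => quad q (z + h * k)) 0.
  rewrite /partial /derive.
  suff -> : (fun h : R => h^-1 *: (((fun y : 'rV[R]_(3 + m) => quad q (y 0 (lshift m 2%:R)))
      \o shift x) (h *: delta_mx 0 i) - quad q (x 0 (lshift m 2%:R)))) =
    (fun h : R => h^-1 *: (((fun h : R => quad q (z + h * k)) \o shift 0) (h *: 1) -
      quad q (z + 0 * k))) by [].
  apply/funext => h /=; rewrite mul0r !addr0 /GRing.scale /= mulr1 !mxE eqxx /= addrC.
  by congr (_ * (quad q (z + h * _) - _)); rewrite eq_sym.
have D : is_derive (0 : R) 1 (fun h : R => quad q (z + h * k)) (k * dquad q z).
  rewrite /quad; apply: is_derive_eq.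
  rewrite /dquad /GRing.scale /=; ring.
rewrite E derive_val /k; case: eqP => _; by rewrite ?mul1r ?mul0r.
Qed.

(** * Coordinate coefficients of the metric, the connection and the Ricci tensor *)

Definition g_coef c (i j : nat) : R * R * R :=
  match i, j with
  | 0%N, 0%N => (- c ^+ 2, 0, 0)
  | 0%N, 1%N | 1%N, 0%N => (0, - c ^+ 2, 0)
  | 1%N, 1%N => (1, 0, - c ^+ 2)
  | _, _ => ((i == j)%:R, 0, 0)
  end.

Lemma gc_coef c m x (i j : 'I_(3 + m)) : c != 0 ->
  gc c m x i j = quad (g_coef c i j) (x 0 (lshift m 2%:R)).
Proof.
move=> c0; rewrite /gc /g3 invmx_frame3 //.
have [i' ->|i' ->] := split_ordP i; have [j' ->|j' ->] := split_ordP j;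
  rewrite ?block_mxEul ?block_mxEur ?block_mxEdl ?block_mxEdr /quad /=.
- rewrite mxE !big_ord_recl big_ord0 !mxE !big_ord_recl !big_ord0 !mxE /=.
  case: i' => [[|[|[|//]]] ?]; case: j' => [[|[|[|//]]] ?] /=; rewrite !mxE /=; ring.
- by case: i' => [[|[|[|//]]] ?]; rewrite mxE /= !mul0r !addr0.
- by case: j' => [[|[|[|//]]] ?]; rewrite mxE /= !mul0r !addr0.
- by rewrite mxE eqSS !mul0r !addr0.
Qed.

Definition ginv_coef c (i j : nat) : R * R * R :=
  match i, j with
  | 0%N, 0%N => (- c ^- 2, 0, 1)
  | 0%N, 1%N | 1%N, 0%N => (0, -1, 0)
  | _, _ => ((i == j)%:R, 0, 0)
  end.

Lemma invmx_gcE c m x : c != 0 -> invmx (gc c m x) =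
  block_mx ((frame3 c (lsubmx x))^T *m signature3 *m frame3 c (lsubmx x)) 0 0 1%:M.
Proof.
move=> c0; set H := block_mx _ _ _ _.
have S2 : @signature3 R *m signature3 = 1%:M.
  rewrite /signature3 mulmx_diag -diag_const_mx; congr diag_mx; apply/rowP => i.
  by rewrite !mxE; case: eqP => _; ring.
have fu := frame3_unit (lsubmx x) c0.
have GH : gc c m x *m H = 1%:M.
  rewrite /gc /g3 /H mulmx_block !mul0mx !mulmx0 !addr0 !add0r mulmx1.
  rewrite [RHS]scalar_mx_block; congr block_mx.
  rewrite !mulmxA -[_ *m _^T *m _^T]mulmxA -trmx_mul mulmxV // trmx1 mulmx1.
  by rewrite -[_ *m _ *m signature3]mulmxA S2 mulmx1 mulVmx.
have gu : gc c m x \in unitmx by have [] := mulmx1_unit GH.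
by rewrite -[LHS]mulmx1 -GH mulKmx.
Qed.

Lemma invmx_gc_coef c m x (i j : 'I_(3 + m)) : c != 0 ->
  invmx (gc c m x) i j = quad (ginv_coef c i j) (x 0 (lshift m 2%:R)).
Proof.
move=> c0; rewrite invmx_gcE //.
have [i' ->|i' ->] := split_ordP i; have [j' ->|j' ->] := split_ordP j;
  rewrite ?block_mxEul ?block_mxEur ?block_mxEdl ?block_mxEdr /quad /=.
- rewrite mxE !big_ord_recl big_ord0 !mxE !big_ord_recl !big_ord0 !mxE /=.
  by case: i' => [[|[|[|//]]] ?]; case: j' => [[|[|[|//]]] ?] /=; rewrite ?mxE /=; by field.
- by case: i' => [[|[|[|//]]] ?]; rewrite mxE /= !mul0r !addr0.
- by case: j' => [[|[|[|//]]] ?]; rewrite mxE /= !mul0r !addr0.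
- by rewrite mxE eqSS !mul0r !addr0.
Qed.

Definition christoffel_coef c (k i j : nat) : R * R * R :=
  match k, i, j with
  | 2%N, 0%N, 1%N | 2%N, 1%N, 0%N => (c ^+ 2 / 2, 0, 0)
  | 2%N, 1%N, 1%N => (0, c ^+ 2, 0)
  | 0%N, 0%N, 2%N | 0%N, 2%N, 0%N => (0, c ^+ 2 / 2, 0)
  | 1%N, 0%N, 2%N | 1%N, 2%N, 0%N => (- (c ^+ 2 / 2), 0, 0)
  | 0%N, 1%N, 2%N | 0%N, 2%N, 1%N => (2^-1, 0, c ^+ 2 / 2)
  | 1%N, 1%N, 2%N | 1%N, 2%N, 1%N => (0, - (c ^+ 2 / 2), 0)
  | _, _, _ => (0, 0, 0)
  end.

Lemma partial_gc c m x (k i j : 'I_(3 + m)) : c != 0 ->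
  partial k (fun y => gc c m y i j) x =
  if val k == 2%N then dquad (g_coef c i j) (x 0 (lshift m 2%:R)) else 0.
Proof.
move=> c0; rewrite -partial_quad; congr partial; apply/funext => y.
exact: gc_coef.
Qed.

(** The coefficient tables are indexed by [nat] for this purpose: sums over [3 + m] indices shrink
    to three terms, and the identities become finite case distinctions independent of [m]. *)
Lemma sum_split3 m (F : nat -> R) : (forall i, F i.+3 = 0) ->
  \sum_(i < 3 + m) F i = F 0%N + F 1%N + F 2%N.
Proof.
move=> F0; rewrite big_split_ord /= [X in _ + X]big1 ?addr0; last by move=> i _; exact: F0.
by rewrite !big_ord_recl big_ord0 /= addr0 !addrA.
Qed.

Lemma christoffel_gc c m x (k i j : 'I_(3 + m)) : c != 0 ->
  christoffel (gc c m) k i j x =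
  quad (christoffel_coef c k i j) (x 0 (lshift m 2%:R)).
Proof.
move=> c0; rewrite /christoffel; set z := x 0 _.
pose d (i j l : nat) := if i == 2%N then dquad (g_coef c j l) z else 0.
pose F (l : nat) := quad (ginv_coef c k l) z * (d i j l + d j i l - d l i j).
rewrite (eq_bigr (fun l : 'I_(3 + m) => F l)); last first.
  by move=> l _; rewrite invmx_gc_coef // !partial_gc.
rewrite (@sum_split3 m F) /F.
  rewrite /d /quad /dquad /=.
  move: (val k) (val i) (val j) => [|[|[|k']]] [|[|[|i']]] [|[|[|j']]] /=; by field.
move=> l; rewrite /d /dquad /=.
move: (val k) (val i) (val j) => [|[|[|k']]] [|[|[|i']]] [|[|[|j']]] /=; rewrite /quad /=; ring.
Qed.

Definition ricci_coef c (z : R) (i j : nat) : R :=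
  match i, j with
  | 0%N, 0%N => c ^+ 4 / 2
  | 0%N, 1%N | 1%N, 0%N => c ^+ 4 * z / 2
  | 1%N, 1%N => c ^+ 2 / 2 + c ^+ 4 * z ^+ 2 / 2
  | 2%N, 2%N => c ^+ 2 / 2
  | _, _ => 0
  end.

(** Christoffel symbols with an index of 3 or more vanish, so both sums stop at 2; for each pair
    [i], [j] a polynomial identity in [z] remains. *)
Lemma ricci_gc_coef c m x (i j : 'I_(3 + m)) : c != 0 ->
  ricci (gc c m) x i j = ricci_coef c (x 0 (lshift m 2%:R)) i j.
Proof.
move=> c0; rewrite mxE; set z := x 0 _.
pose G (k i j : nat) := quad (christoffel_coef c k i j) z.
pose d (l k i j : nat) := if l == 2%N then dquad (christoffel_coef c k i j) z else 0.
have dE (l k i' j' : 'I_(3 + m)) : partial l (christoffel (gc c m) k i' j') x = d l k i' j'.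
  rewrite /d -partial_quad; congr partial; apply/funext => y.
  exact: christoffel_gc.
pose F1 (k : nat) := d k k i j - d j k i k.
rewrite (eq_bigr (fun k : 'I_(3 + m) => F1 k)); last first.
  by move=> k _; rewrite !dE.
rewrite (@sum_split3 m F1) /F1; last first.
  move=> k; rewrite /d /dquad /=.
  move: (val i) (val j) => [|[|[|i']]] [|[|[|j']]] /=; ring.
pose F2 (k l : nat) := G k k l * G l i j - G k j l * G l i k.
pose F3 k := F2 k 0%N + F2 k 1%N + F2 k 2%N.
rewrite (eq_bigr (fun k : 'I_(3 + m) => F3 k)); last first.
  move=> k _; rewrite /F3 -(@sum_split3 m (F2 k)).
    by apply: eq_bigr => l _; rewrite !christoffel_gc.
  move=> l; rewrite /F2 /G /quad /=.
  move: (val k) (val i) (val j) => [|[|[|k']]] [|[|[|i']]] [|[|[|j']]] /=; ring.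
rewrite (@sum_split3 m F3) /F3 /F2; last first.
  move=> k; rewrite /G /quad /=.
  move: (val i) (val j) => [|[|[|i']]] [|[|[|j']]] /=; ring.
rewrite /d /G /quad /dquad.
move: (val i) (val j) => [|[|[|i']]] [|[|[|j']]] /=; by field.
Qed.

(** * Curvature in the orthonormal frame *)

Definition ricci_diag c m : 'rV[R]_(3 + m) := row_mx (const_mx (c ^+ 2 / 2)) 0.

Lemma ricci_gc c m x : c != 0 ->
  ricci (gc c m) x = coframe c x *m diag_mx (ricci_diag c m) *m (coframe c x)^T.
Proof.
move=> c0; rewrite /coframe /ricci_diag diag_mx_row diag_const_mx raddf0.
rewrite tr_block_mx !mulmx_block !trmx0 !mul0mx !mulmx0 !addr0 !mul0mx !addr0.
rewrite mul_mx_scalar -scalemxAl.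
apply/matrixP => i j; rewrite ricci_gc_coef //.
have [i' ->|i' ->] := split_ordP i; have [j' ->|j' ->] := split_ordP j;
  rewrite ?block_mxEul ?block_mxEur ?block_mxEdl ?block_mxEdr /=.
- rewrite !mxE !big_ord_recl big_ord0 !mxE /=.
  by case: i' => [[|[|[|//]]] ?]; case: j' => [[|[|[|//]]] ?] /=; rewrite ?mxE /=; field.
- by case: i' => [[|[|[|//]]] ?]; rewrite mxE.
- by case: j' => [[|[|[|//]]] ?]; rewrite mxE.
- by rewrite mxE.
Qed.

Lemma gc_sign_sqr m i : gc_sign m 0 i ^+ 2 = 1.
Proof.
rewrite /gc_sign; have [j ->|j ->] := split_ordP i; rewrite ?row_mxEl ?row_mxEr mxE.
  by case: eqP => _; ring.
by rewrite expr1n.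
Qed.

Lemma diag_gc_sign_sqr m : diag_mx (gc_sign m) *m diag_mx (gc_sign m) = 1%:M.
Proof.
rewrite mulmx_diag -diag_const_mx; congr diag_mx; apply/rowP => i.
by rewrite mxE -expr2 gc_sign_sqr mxE.
Qed.

Lemma invmx_gc c m x : c != 0 -> invmx (gc c m x) =
  (invmx (coframe c x))^T *m diag_mx (gc_sign m) *m invmx (coframe c x).
Proof.
move=> c0; have cu := coframe_unit x c0; set H := RHS.
have GH : gc c m x *m H = 1%:M.
  rewrite gcE // /H !mulmxA -[_ *m _^T *m _^T]mulmxA -trmx_mul mulVmx // trmx1 mulmx1.
  by rewrite -[_ *m _ *m diag_mx _]mulmxA diag_gc_sign_sqr mulmx1 mulmxV.
have gu : gc c m x \in unitmx by have [] := mulmx1_unit GH.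
by rewrite -[LHS]mulmx1 -GH mulKmx.
Qed.

(** The coframe cancels in the trace by cyclicity, leaving [(-1 + 1 + 1) * (c ^+ 2 / 2)]. *)
Lemma scal_gc c m x : c != 0 -> scal (gc c m) x = c ^+ 2 / 2.
Proof.
move=> c0; have cu := coframe_unit x c0.
rewrite /scal invmx_gc // ricci_gc // !mulmxA -[_ *m _ *m coframe _ _]mulmxA mulVmx // mulmx1.
rewrite mxtrace_mulC !mulmxA -trmx_mul mulVmx // trmx1 mul1mx mulmx_diag mxtrace_diag.
rewrite big_split_ord /= [X in _ + X]big1 => [|j _]; last first.
  by rewrite mxE /gc_sign /ricci_diag !row_mxEr !mxE mulr0.
rewrite !big_ord_recl big_ord0 !(mxE matrix_key) /gc_sign /ricci_diag !row_mxEl !mxE /=.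
by field.
Qed.

(** The coefficient of [gc_sign] is [Lambda] minus half the scalar curvature. *)
Definition em_diag Lambda c m : 'rV[R]_(3 + m) :=
  ricci_diag c m + (Lambda - c ^+ 2 / 4) *: gc_sign m.

Lemma energy_momentum_gc Lambda c m x : c != 0 ->
  energy_momentum (gc c m) Lambda x =
  coframe c x *m diag_mx (em_diag Lambda c m) *m (coframe c x)^T.
Proof.
move=> c0; rewrite /energy_momentum scal_gc // ricci_gc // gcE //.
have -> : diag_mx (em_diag Lambda c m) =
    diag_mx (ricci_diag c m) + (Lambda - c ^+ 2 / 4) *: diag_mx (gc_sign m).
  by rewrite /em_diag raddfD /= linearZ.
rewrite mulmxDr mulmxDl -scalemxAr -scalemxAl.
rewrite -addrA -scaleNr -scalerDl; congr (_ + _ *: _); by field.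
Qed.

(** Raising the index multiplies frame components by the signs, whose squares are 1; so the entries
    of [T] enter squared, with the signs of the metric. *)
Lemma sharp_gc_eval Lambda c m x v : c != 0 ->
  let u := - sharp (gc c m) x (v *m energy_momentum (gc c m) Lambda x) in
  tensor_eval (gc c m) x u u =
  diag_eval (\row_i (gc_sign m 0 i * em_diag Lambda c m 0 i ^+ 2)) (v *m coframe c x).
Proof.
move=> c0 u; have cu := coframe_unit x c0; rewrite gc_eval //.
have -> : u *m coframe c x = - (v *m coframe c x *m diag_mx (em_diag Lambda c m) *m diag_mx (gc_sign m)).
  rewrite /u /sharp energy_momentum_gc // invmx_gc // mulNmx; congr (- _).
  rewrite !mulmxA -[_ *m _^T *m _^T]mulmxA -trmx_mul mulVmx // trmx1 mulmx1.
  by rewrite -[_ *m _ *m coframe _ _]mulmxA mulVmx // mulmx1.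
rewrite /diag_eval; apply: eq_bigr => i _.
move: (v *m _) (em_diag _ _ _) => w d.
have -> : (- (w *m diag_mx d *m diag_mx (gc_sign m))) 0 i = - (w 0 i * d 0 i * gc_sign m 0 i).
  by rewrite mxE mul_mx_diag mxE mul_mx_diag mxE.
have -> : (\row_j (gc_sign m 0 j * d 0 j ^+ 2)) 0 i = gc_sign m 0 i * d 0 i ^+ 2 by rewrite mxE.
have -> : forall a b w : R, a * (- (w * b * a)) ^+ 2 = a ^+ 2 * (a * b ^+ 2 * w ^+ 2).
  by move=> a b ?; ring.
by rewrite gc_sign_sqr mul1r.
Qed.

(** In frame components [w], timelike means that [w 0 o ^+ 2] exceeds the sum [W] of the other
    squares. Both claims follow by bounding each other diagonal entry of [T] by [D 0 o]. *)
Lemma dominant_energy_condition_gc Lambda c m : 1 <= c -> 4 * `|Lambda| <= c ->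
  dominant_energy_condition (gc c m) Lambda.
Proof.
move=> c1 cL; rewrite /dominant_energy_condition /timelike /spacelike; cbv zeta.
move=> p v; have c0 : c != 0 by rewrite gt_eqF //; lra.
have cc : c <= c ^+ 2 by rewrite expr2 ler_peMl //; lra.
rewrite gc_eval // sharp_gc_eval //.
have -> : tensor_eval (energy_momentum (gc c m) Lambda) p v v = diag_eval (em_diag Lambda c m) (v *m coframe c p).
  by rewrite -mul_diag_eval /tensor_eval energy_momentum_gc // trmx_mul !mulmxA.
move: (v *m coframe c p) => w.
set D := em_diag Lambda c m; set o := lshift m (0 : 'I_3).
have Do : D 0 o = 3 / 4 * c ^+ 2 - Lambda.
  by rewrite /D /o /em_diag /ricci_diag /gc_sign mxE row_mxEl mxE [in X in _ + X]mxE row_mxEl mxE /=; field.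
have Lb : - `|Lambda| <= Lambda <= `|Lambda| by rewrite lerNnormlW // ler_norm.
(* The tightest case is [c ^+ 2 / 4 + Lambda <= 3 / 4 * c ^+ 2 - Lambda], that is
   [4 * Lambda <= c ^+ 2]. *)
have Di i : `|D 0 i| <= D 0 o.
  have -> : D 0 i = ricci_diag c m 0 i + (Lambda - c ^+ 2 / 4) * gc_sign m 0 i.
    by rewrite /D /em_diag mxE; congr (_ + _); rewrite mxE.
  rewrite Do ler_norml /ricci_diag /gc_sign.
  have [j ->|j ->] := split_ordP i; rewrite ?row_mxEl ?row_mxEr !mxE.
    by case: eqP => _; apply/andP; split; lra.
  by apply/andP; split; lra.
have D0 : 0 <= D 0 o by apply: le_trans (Di o).
have so : gc_sign m 0 o = -1 by rewrite /o /gc_sign row_mxEl mxE.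
have si i : i != o -> gc_sign m 0 i = 1.
  rewrite /gc_sign; have [j ->|j ->] := split_ordP i; rewrite ?row_mxEl ?row_mxEr !mxE //.
  by rewrite /o (inj_eq (@lshift_inj _ _)) => /negbTE ->.
rewrite /diag_eval (bigD1 o) //= so.
rewrite (eq_bigr (fun i => w 0 i ^+ 2)); last by move=> i /si ->; rewrite mul1r.
set W := \sum_(i | _) _ => Ww; split.
  rewrite (bigD1 o) //=.
  have : - (D 0 o * W) <= \sum_(i | i != o) D 0 i * w 0 i ^+ 2.
    rewrite /W mulr_sumr -sumrN; apply: ler_sum => i _.
    by rewrite -mulNr ler_wpM2r ?sqr_ge0 // lerNl (le_trans (ler_norm _)) // normrN.
  have : D 0 o * W <= D 0 o * w 0 o ^+ 2 by rewrite ler_wpM2l //; lra.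
  lra.
apply/negP; rewrite -leNgt (bigD1 o) //= mxE so.
have : \sum_(i | i != o) (\row_i (gc_sign m 0 i * D 0 i ^+ 2)) 0 i * w 0 i ^+ 2 <= D 0 o ^+ 2 * W.
  rewrite /W mulr_sumr; apply: ler_sum => i io; rewrite mxE si // mul1r.
  rewrite ler_wpM2r ?sqr_ge0 //.
  by rewrite -[D 0 i ^+ 2]real_normK ?num_real // lerXn2r ?nnegrE.
have : D 0 o ^+ 2 * W <= D 0 o ^+ 2 * w 0 o ^+ 2 by rewrite ler_wpM2l ?sqr_ge0 //; lra.
lra.
Qed.

End GcGeometry.

(** * From foliated charts to first integrals on a slice *)

(** Compactness is used in its near-covering form, with radii tending to 0 from the right: half of a
    radius that works at a point works at all nearby points. *)
Lemma lebesgue_number {R : realType} {T : pseudoMetricType R} {I : Type}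
    (K : set T) (G : I -> set T) : compact K ->
  (forall x, K x -> exists i, \forall y \near x, G i y) ->
  exists2 r : R, 0 < r & forall x, K x -> exists i, ball x r `<=` G i.
Proof.
move=> /compact_near_coveringP cK KG.
have [|/= r [r0 rP]] := @filter_ex _ (0^'+ : set_system R) _
  (fun r => 0 < r /\ forall x, K x -> exists i, ball x r `<=` G i); last by exists r.
apply: filterI; first exact: nbhs_right_gt.
apply: (cK R 0^'+ (fun r x => exists i, ball x r `<=` G i)).
move=> x /KG[i /nbhs_ballP[e /= e0 eG]].
exists (ball x (e / 2), [set r : R | r < e / 2]) => /=.
  split; first by apply: nbhsx_ballx; rewrite divr_gt0.
  by apply: nbhs_right_lt; rewrite divr_gt0.
move=> [x' r] /= [xx' re]; exists i => y x'y; apply: eG.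
rewrite [e]splitr; apply: ball_triangle xx' _.
by apply: le_ball x'y; exact: ltW.
Qed.

Section Charts.
Context {R : realType} {m : nat}.
Notation E := 'rV[R]_(3 + m).
Notation x2 q := (q 0 (lshift m 2%:R)).

Lemma is_derive_dir0 (V : normedModType R) (f : V -> R) (x : V) :
  is_derive x 0 f 0.
Proof.
have F : (fun h : R => h^-1 *: ((f \o shift x) (h *: (0 : V)) - f x)) = (fun=> 0).
  by apply/funext => h /=; rewrite scaler0 add0r subrr scaler0.
by split; rewrite /derivable /derive F; [exact: is_cvg_cst|exact: lim_cst].
Qed.

(** [is_deriveDr] adds the three coordinate directions one at a time, starting from the zero
    direction. *)
Lemma C1_derive (V : set E) (f : E -> R) (q : E) (t s y : R) :
  open V -> Ck_on 1 V f -> V q ->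
  is_derive q (t *: slice_dir m 0 + s *: slice_dir m 1 + y *: slice_dir m 2%:R) f
    (t * partial (lshift m 0) f q + s * partial (lshift m 1) f q +
     y * partial (lshift m 2%:R) f q).
Proof.
move=> oV [_ D1] Vq.
have Vn : \forall q' \near q, V q' by exact: open_nbhs_nbhs.
have dn i : \forall q' \near q, derivable f q' (delta_mx 0 i).
  by apply: filterS Vn => q' /(proj1 (D1 i)).
have cn i : {for q, continuous (fun q' => 'D_(delta_mx 0 i) f q')}.
  by have [_ [+ _]] := D1 i; exact.
have := is_deriveDr t (is_derive_dir0 f q) (dn (lshift m 0)) (cn _).
rewrite !add0r => d0.
have d1 := is_deriveDr s d0 (dn (lshift m 1)) (cn _).
exact: (is_deriveDr y d1 (dn (lshift m 2%:R)) (cn _)).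
Qed.

Definition plaque_coord (C : set E * (E -> E)) : E -> R := transverse C.2.

Lemma chart_C1 (C : set E * (E -> E)) : is_chart C.1 C.2 ->
  open C.1 /\ Ck_on 1 C.1 (plaque_coord C).
Proof. by move=> [oV _ sm _]; split => //; exact: (sm ord_max 1%N). Qed.

(** A vector killed by the derivative of the transverse coordinate is tangent to a leaf, hence not
    timelike. The [x_0] direction is timelike, so [f 0 != 0]; the kernel vectors with [(s, y)] equal
    to [(1, 0)] and [(0, 1)] give the slope bounds. *)
Lemma chart_slopes (c : R) (A : set (set E * (E -> E))) C (q : E) :
  0 < c -> (forall p v, tangent_to_leaf A p v -> ~ timelike (gc c m) p v) ->
  A C -> is_chart C.1 C.2 -> C.1 q ->
  let f i := partial (lshift m i) (plaque_coord C) q in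
  [/\ f 0 != 0, `|f 1 / f 0 - x2 q| <= c^-1 & `|f 2%:R / f 0| <= c^-1].
Proof.
move=> c0 nt AC chC Cq f; have cn0 : c != 0 by rewrite gt_eqF.
have nt3 t s y : t * f 0 + s * f 1 + y * f 2%:R = 0 ->
    (c * (t + x2 q * s)) ^+ 2 <= s ^+ 2 + y ^+ 2.
  move=> fv; rewrite -subr_ge0 leNgt; apply/negP => neg.
  apply: (nt q (t *: slice_dir m 0 + s *: slice_dir m 1 + y *: slice_dir m 2%:R)).
    exists C; split => //.
    have [oC C1] := chart_C1 chC.
    by have /@derive_val -> := C1_derive t s y oC C1 Cq.
  by rewrite /timelike gc_eval3 //; lra.
have sq1 (k : R) : (c * k) ^+ 2 <= 1 -> `|k| <= c^-1.
  move=> h; rewrite -[c^-1]mul1r ler_pdivlMr // -[X in _ * X]gtr0_norm // -normrM.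
  by rewrite -[leRHS]sqrtr1 -sqrtr_sqr ler_sqrt ?ler01 // mulrC.
have f0 : f 0 != 0.
  apply/eqP => f0; have := nt3 1 0 0; rewrite f0 !mul0r mulr0 !addr0 => /(_ erefl).
  rewrite mulr0 addr0 mulr1 expr0n /= addr0 => h.
  by have : 0 < c ^+ 2 by [rewrite exprn_gt0]; lra.
split => //; apply: sq1.
  have := nt3 (- (f 1 / f 0)) 1 0.
  rewrite mulNr divfK // mul1r mul0r addr0 addNr => /(_ erefl).
  rewrite expr0n /= expr1n addr0 mulr1; congr (_ <= _); ring.
have := nt3 (- (f 2%:R / f 0)) 0 1.
rewrite mulNr divfK // mul1r mul0r addr0 addNr => /(_ erefl).
rewrite expr0n /= expr1n add0r mulr0 addr0; congr (_ <= _); ring.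
Qed.

(** * The three-dimensional slice through a point *)

Context (c : R) (p : E) (A : set (set E * (E -> E))) (U : set E).

Definition slice (t s y : R) : E := p + (t *: slice_dir m 0 + s *: slice_dir m 1 + y *: slice_dir m 2%:R).

(* A chart together with a sign, chosen so that the signed transverse coordinate
   increases in the direction of [x_0]. *)
Definition slice_dom (i : (set E * (E -> E)) * bool) (t s y : R) :=
  A i.1 /\ i.1.1 (slice t s y).

Definition slice_fun (i : (set E * (E -> E)) * bool) (t s y : R) :=
  (-1) ^+ i.2 * plaque_coord i.1 (slice t s y).

(** The summand 1 makes the estimate of [slice_dist] strict. *)
Definition slice_norm := 1 + `|slice_dir m 0 : E| + `|slice_dir m 1 : E| + `|slice_dir m 2%:R : E|.

Lemma slice_norm_gt0 : 0 < slice_norm.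
Proof.
rewrite /slice_norm; have := normr_ge0 (slice_dir m 0 : E).
have := normr_ge0 (slice_dir m 1 : E); have := normr_ge0 (slice_dir m 2%:R : E); lra.
Qed.

Lemma slice_dist (t s y t' s' y' d : R) : 0 < d ->
  `|t' - t| <= d -> `|s' - s| <= d -> `|y' - y| <= d ->
  `|slice t s y - slice t' s' y'| < d * slice_norm.
Proof.
move=> d0 td sd yd.
have -> : slice t s y - slice t' s' y' =
    (t - t') *: slice_dir m 0 + (s - s') *: slice_dir m 1 + (y - y') *: slice_dir m 2%:R.
  rewrite /slice !scalerBl; apply/rowP => i; rewrite !mxE; ring.
rewrite (le_lt_trans (ler_normD _ _)) // (@le_lt_trans _ _ (d * `|slice_dir m 0 : E| + d * `|slice_dir m 1 : E| + d * `|slice_dir m 2%:R : E|)) //.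
  rewrite lerD // ?(le_trans (ler_normD _ _)) // ?lerD // normrZ ler_wpM2r //.
  - by rewrite distrC.
  - by rewrite distrC.
  - by rewrite distrC.
by rewrite /slice_norm; lra.
Qed.

Lemma x2_slice t s y : x2 (slice t s y) = x2 p + y.
Proof.
rewrite /slice /slice_dir !mxE /=; ring.
Qed.

Lemma slice_compatible : codim1_foliation U A ->
  compatible slice_dom slice_fun.
Proof.
move=> [_ _ trans] [C b] [C' b'] t s y [/= AC Ct] [/= AC' C't].
have [h /nbhs_ballP[e /= e0 eh]] := trans _ _ AC AC' _ Ct C't.
(* The sign of the first chart is undone, the transition map applied, and the sign of the second
   chart put on. *)
exists (fun v => (-1) ^+ b' * h ((-1) ^+ b * v)).
have L0 := slice_norm_gt0.
exists (e / slice_norm); first by rewrite divr_gt0.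
move=> t' s' y' tt' [ss' yy']; rewrite /slice_fun /= mulrA -expr2 sqrr_sign mul1r.
rewrite -eh // -ball_normE /=.
have := @slice_dist t s y t' s' y' (e / slice_norm).
by rewrite divfK ?gt_eqF //; apply; [rewrite divr_gt0|exact: ltW|exact: ltW|exact: ltW].
Qed.

Lemma slice_seg (t s y t' s' y' k : R) :
  slice (t + k * (t' - t)) (s + k * (s' - s)) (y + k * (y' - y)) =
  slice t s y +
    k *: ((t' - t) *: slice_dir m 0 + (s' - s) *: slice_dir m 1 + (y' - y) *: slice_dir m 2%:R).
Proof. by rewrite /slice; apply/rowP => i; rewrite !mxE; ring. Qed.

Lemma seg_ball (a0 a a' r k : R) : 0 <= k <= 1 -> `|a - a0| < r ->
  `|a' - a0| < r -> `|a + k * (a' - a) - a0| < r.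
Proof.
move=> /andP[k0 k1] ar a'r; pose X := `|a - a0|; pose Y := `|a' - a0|.
have mr : Num.max X Y < r by rewrite gt_max ar.
apply: le_lt_trans mr.
rewrite (_ : _ - _ = (1 - k) * (a - a0) + k * (a' - a0)); last by ring.
rewrite (le_trans (ler_normD _ _)) // !normrM (ger0_norm k0) ger0_norm ?subr_ge0 //.
rewrite -/X -/Y; set mx := Num.max X Y.
have Xm : X <= mx by rewrite le_max lexx.
have Ym : Y <= mx by rewrite le_max lexx orbT.
have : (1 - k) * X <= (1 - k) * mx by rewrite ler_wpM2l // subr_ge0.
have : k * Y <= k * mx by rewrite ler_wpM2l.
lra.
Qed.

Lemma slice_adapted C (b : bool) (r t0 s0 y0 : R) :
  (forall p v, tangent_to_leaf A p v -> ~ timelike (gc c m) p v) ->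
  0 < c -> 0 < r -> A C -> is_chart C.1 C.2 ->
  ball (slice t0 s0 y0) (r * slice_norm) `<=`
    [set q | C.1 q /\ 0 < (-1) ^+ b * partial (lshift m 0) (plaque_coord C) q] ->
  adapted slice_dom slice_fun (x2 p) c^-1 r (C, b) t0 s0 y0.
Proof.
move=> nt c0 r0 AC chC sub.
have inC t s y : `|t - t0| < r -> close r s0 y0 s y ->
    C.1 (slice t s y) /\ 0 < (-1) ^+ b * partial (lshift m 0) (plaque_coord C) (slice t s y).
  move=> tr [sr yr]; apply: sub; rewrite -ball_normE /=.
  by apply: slice_dist => //; exact: ltW.
have [oC C1] := chart_C1 chC; split.
- by move=> t s y tr sy; split=> //=; have [] := inC _ _ _ tr sy.
- move=> t s y t' s' y' tr sy t'r sy' lt_sl.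
  pose v : E := (t' - t) *: slice_dir m 0 + (s' - s) *: slice_dir m 1 + (y' - y) *: slice_dir m 2%:R.
  pose f i q := partial (lshift m i) (plaque_coord C) q.
  pose df q := (t' - t) * f 0 q + (s' - s) * f 1 q + (y' - y) * f 2%:R q.
  pose g (k : R) := plaque_coord C (slice t s y + k *: v).
  have gin (k : R) : 0 <= k <= 1 -> C.1 (slice t s y + k *: v) /\
      0 < (-1) ^+ b * f 0 (slice t s y + k *: v).
    move=> k01; rewrite -slice_seg; apply: inC; first exact: seg_ball.
    by case: sy sy' => ? ? [? ?]; split; exact: seg_ball.
  have gd (k : R) : 0 <= k <= 1 -> is_derive k 1 g (df (slice t s y + k *: v)).
    move=> k01; apply: is_derive_line; apply: C1_derive oC C1 _.
    by have [] := gin k k01.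
  have [|||k k01] := @MVT_segment R g (fun k => df (slice t s y + k *: v)) 0 1.
  - by [].
  - by move=> k kin; apply: gd; rewrite !ltW ?(itvP kin).
  - apply: derivable_within_continuous => k; rewrite in_itv /= => k01.
    by have [] := gd k k01.
  rewrite in_itv /= in k01; rewrite /g scale1r scale0r addr0 subr0 mulr1.
  have -> : slice t s y + v = slice t' s' y'.
    by rewrite -[v]scale1r -slice_seg !mul1r ![_ + (_ - _)]addrC !subrK.
  move=> E; rewrite /slice_fun /= -subr_gt0 -mulrBr E.
  have [Cq f0] := gin k k01.
  have x2q : x2 (slice t s y + k *: v) = x2 p + (y + k * (y' - y)).
    by rewrite -slice_seg x2_slice.
  have [f00 f1 f2] := chart_slopes c0 nt AC chC Cq; rewrite x2q in f1.
  move: f0 f00 f1 f2; rewrite /df -!/(f _ _).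
  move: (f 0 _) (f 1 _) (f 2%:R _) => F0 F1 F2 f0 f00 f1 f2.
  (* The derivative at the mean value point is [F0] times [lean] plus three errors: [y] at that
     point against the midpoint, and the deviations of two slopes, at most [c^-1] by [chart_slopes].
     Together they are at most [slack]. *)
  have -> : (t' - t) * F0 + (s' - s) * F1 + (y' - y) * F2 =
      F0 * (lean (x2 p) t s y t' s' y' + (k - 2^-1) * (y' - y) * (s' - s) +
      (F1 / F0 - (x2 p + (y + k * (y' - y)))) * (s' - s) + (F2 / F0) * (y' - y)).
    by rewrite /lean; field.
  rewrite mulrA mulr_gt0 //.
  have h1 : `|(k - 2^-1) * (y' - y) * (s' - s)| <= `|y' - y| * `|s' - s|.
    rewrite !normrM ler_wpM2r // ler_piMl // ler_norml; move/andP: k01 => [? ?].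
    by apply/andP; split; lra.
  have h2 : `|(F1 / F0 - (x2 p + (y + k * (y' - y)))) * (s' - s)| <= c^-1 * `|s' - s|.
    by rewrite normrM ler_wpM2r.
  have h3 : `|(F2 / F0) * (y' - y)| <= c^-1 * `|y' - y| by rewrite normrM ler_wpM2r.
  move: lt_sl h1 h2 h3; rewrite /slack !ler_norml => ? /andP[? ?] /andP[? ?] /andP[? ?].
  lra.
- move=> t s y tr sy; have [Ct _] := inC _ _ _ tr sy.
  rewrite /slice_fun /=; apply: continuousM; first exact: cst_continuous.
  apply: (@continuous_comp R E R (fun t => slice t s y) (plaque_coord C)); last by case: C1 => + _; apply.
  rewrite /slice; apply: cvgD; first exact: cvg_cst.
  apply: cvgD; last exact: cvg_cst.
  apply: cvgD; last exact: cvg_cst.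
  apply: cvgZr_tmp; exact: cvg_id.
Qed.

End Charts.

(** * Choice of constants and conclusion *)

Theorem theorem0p4 (R : realType) (m : nat) (Lambda : R)
    (U : set 'rV[R]_(3 + m)) (hU : open U) (hU0 : U !=set0) :
  exists2 c0 : R, 0 < c0 &
    forall c : R, c0 <= c ->
      [/\ ~ (exists A, codim1_foliation U A /\
               forall p v, tangent_to_leaf A p v -> ~ timelike (gc c m) p v),
          ~ (exists A, space_foliation (gc c m) U A) &
          dominant_energy_condition (gc c m) Lambda].
Proof.
have [p Up] := hU0.
have /nbhs_ballP[r0 /= r00 r0U] : nbhs p U by exact: open_nbhs_nbhs.
pose L : R := slice_norm (m := m); have L0 : 0 < L := slice_norm_gt0.
(* Since [rho * L = r0 / 2], slice points with coordinates at most [rho] in absolute value lie in a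
   compact ball inside [U]. *)
pose rho := r0 / (2 * L); have rho0 : 0 < rho by rewrite divr_gt0 // mulr_gt0.
pose b := p 0 (lshift m (2%:R : 'I_3)).
(* This exceeds [|b| + 2 * delta + eps], because [delta <= rho] and [eps = c^-1 <= 1]. *)
pose M := `|b| + 2 * rho + 2.
have M2 : 2 <= M by rewrite /M; have := normr_ge0 b; lra.
pose delta := rho / (2 * M).
have delta0 : 0 < delta by rewrite divr_gt0 // mulr_gt0 //; lra.
have Mdelta : 2 * M * delta = rho by rewrite /delta; field; lra.
have delta_rho : delta <= rho by nra.
have d5 : 0 < 5 / delta by rewrite divr_gt0.
have L4 := normr_ge0 Lambda.
(* The three summands ensure [c^-1 <= 1], contradict [delta <= 4 / c], and give the dominant energy
   condition. *)
exists (1 + 5 / delta + 4 * `|Lambda|) => [|c hc]; first by lra.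
have c0 : 0 < c by lra.
have nofol : ~ (exists A, codim1_foliation U A /\
    forall p v, tangent_to_leaf A p v -> ~ timelike (gc c m) p v).
  move=> [A [fol nt]].
  have [chA covA _] := fol.
  have KE x : closed_ball p (r0 / 2) x <-> `|p - x| <= r0 / 2.
    by rewrite closed_ballE // divr_gt0.
  have cK : compact (closed_ball p (r0 / 2)).
    apply: bounded_closed_compact; last exact: closed_ball_closed.
    exists (`|p| + r0 / 2); split; first exact: num_real.
    move=> M' ltM x /KE px; apply/ltW/(le_lt_trans _ ltM).
    by rewrite -[x](subrKC p) (le_trans (ler_normD _ _)) // lerD2l distrC.
  have KU : closed_ball p (r0 / 2) `<=` U.
    by move=> x /KE px; apply: r0U; rewrite -ball_normE /=; lra.
  (* Near each point of the ball one chart and one sign work; the Lebesgue number turns this into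
     the uniform radius asked for by [covered]. *)
  pose G (i : {C | A C} * bool) : set 'rV[R]_(3 + m) := [set q | (sval i.1).1 q /\
      0 < (-1) ^+ i.2 * partial (lshift m 0) (plaque_coord (sval i.1)) q].
  have [|r r_gt0 rG] := @lebesgue_number R _ _ _ G cK.
    move=> x /KU /covA[C AC Cx]; have [_ chC] := chA _ AC.
    have [oC [_ C1]] := chart_C1 chC.
    have [f0 _ _] := chart_slopes c0 nt AC chC Cx.
    (* The exponent is the truth value of negativity, so the signed derivative at [x] is its
       absolute value. *)
    exists (exist _ C AC, partial (lshift m 0) (plaque_coord C) x < 0).
    rewrite /G /=; near=> q; split.
      by near: q; exact: open_nbhs_nbhs.
    near: q; have [_ [ct _]] := C1 (lshift m 0).
    have {}ct : {for x, continuous (fun q => (-1) ^+ (partial (lshift m 0) (plaque_coord C) x < 0)%R *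
        partial (lshift m 0) (plaque_coord C) q)}.
      by apply: continuousM; [exact: cst_continuous|exact: ct].
    by apply: (cvgr_gt _ ct); rewrite -normrEsign normr_gt0.
  have : delta <= 4 * c^-1.
    apply: (@square_bound R _ (slice_dom p A) (@slice_fun R m p) b c^-1 rho delta (r / L) M).
    - exact: slice_compatible fol.
    - move=> t s y tr [/andP[s1 s2] /andP[y1 y2]].
      have [|[[C AC] bb] /= Gi] := rG (slice p t s y).
        have p0 : p = slice p 0 0 0 by rewrite /slice !scale0r !addr0.
        apply/KE; rewrite {1}p0 (_ : r0 / 2 = rho * L); last by rewrite /rho; field; lra.
        apply: ltW; apply: (slice_dist _ rho0); rewrite subr0 // ger0_norm //; lra.
      exists (C, bb); apply: (slice_adapted nt) => //.
      + by rewrite divr_gt0.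
      + by have [] := chA _ AC.
      + by rewrite divfK ?gt_eqF.
    - have ci1 : c^-1 <= 1 by rewrite invf_le1 //; lra.
      split => //; [by rewrite invr_gt0|by rewrite divr_gt0|lra|rewrite /M; lra].
    - by rewrite Mdelta.
  apply/negP; rewrite -ltNge -ltr_pdivlMr ?invr_gt0 // invrK.
  have : 5 / delta < c by lra.
  rewrite ltr_pdivrMr //; lra.
split => //.
  move=> [A [fol sp]]; apply: nofol; exists A; split => // q v tv.
  have [->|v0] := eqVneq v 0.
    by rewrite /timelike /tensor_eval mul0mx mul0mx mxE ltxx.
  by have := sp _ _ tv v0; rewrite /spacelike /timelike => ? ?; lra.
apply: dominant_energy_condition_gc; lra.
Unshelve. all: by end_near.
Qed.
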